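(* Let $(W,S)$ be a finite Coxeter system with finite root system $\Phi$ and associated matroid $M_\Phi$ (ground set $\Phi^+$). Then the coarse subdivision of the Bergman complex $\mathcal{B}(M_\Phi)$ is equal to the nested set complex $\mathcal{N}(M_\Phi)$; that is, for $\omega,\nu\in\mathcal{B}(M_\Phi)$ one has $M_{\mathcal{F}(\omega)}=M_{\mathcal{F}(\nu)}$ if and only if $N(\mathcal{F}(\omega))=N(\mathcal{F}(\nu))$. In particular, $\mathcal{B}(M_\Phi)$ (with its coarse subdivision) is a simplicial complex.
   Context: Coxeter system $(W,S)$, $W$ finite, $S$ finite, with relations $(ss')^{m(s,s')}=1$. Geometric representation: $V=\mathbb{R}^S$ with basis $\Delta=\{\alpha_s\}$, bilinear form $(\alpha_s,\alpha_{s'})=-\cos(\pi/m(s,s'))$, $s(v)=v-2(v,\alpha_s)\alpha_s$; roots $\Phi=\{w(\alpha_s)\}$, positive roots $\Phi^+$ those with nonnegative coefficients in $\Delta$. $M_\Phi$ is the matroid of the vector configuration $\Phi^+$ in $V$ (finite ground set $E=\Phi^+$, identify $\mathbb{R}^E$ with $\mathbb{R}^n$, $n=|\Phi^+|$). For a matroid $M$ on $E=[n]$ and $\omega\in\mathbb{R}^n$, $\mathcal{F}(\omega)$ is the unique chain $\emptyset=F_0\subsetneq F_1\subsetneq\cdots\subsetneq F_{k+1}=[n]$ such that $\omega$ is constant on each $F_i\setminus F_{i-1}$ and its value there is strictly smaller than its value on $F_{i+1}\setminus F_i$. For a flag of flats $\mathcal{F}$ of this form, $M_{\mathcal{F}}=\bigoplus_{i=1}^{k+1}F_i/F_{i-1}$,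 where $F_i/F_{i-1}$ is the restriction of $M$ to $F_i$ with $F_{i-1}$ contracted. The Bergman complex is $\mathcal{B}(M)=\{\omega\in S^{n-2}:\mathcal{F}(\omega)\text{ is a flag of flats of }M\}$ with $S^{n-2}=\{\omega:\sum\omega_i=0,\ \sum\omega_i^2=1\}$; its coarse subdivision is the partition into classes $\{\omega: M_{\mathcal{F}(\omega)}=N\}$. Connected components of a matroid are the classes of the transitive closure of ''lying in a common circuit''; a flat $F$ is connected if the restriction $M|_F$ is connected, and the connected components of a flat $F$ are those of $M|_F$ (they are flats). For a flag of flats $\mathcal{F}$, $N(\mathcal{F})$ denotes the set of all connected components of all the flats $F_1,\dots,F_{k+1}=E$. A set $N$ of nonempty connected flats is nested if for every antichain $\{G_1,\dots,G_t\}\subseteq N$ with $t\ge2$ the join $G_1\vee\cdots\vee G_t$ in the lattice of flats is not connected; the nested set complex $\mathcal{N}(M)$ is the simplicial complex of nested sets, realized inside $\mathcal{B}(M)$ by assigning to each nested set $N$ containing all connected components of $M$ the union of the fine cells $\{\omega:\mathcal{F}(\omega)=\mathcal{F}\}$ over flags $\mathcal{F}$ with $N(\mathcal{F})=N$.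
   Formalization: The claim that the complex is simplicial is proved modulo the space of sum-zero vectors constant on the connected components of the matroid; this space is zero when W is irreducible, while for reducible W (e.g. A1×A1, where one coarse cell is two points) the literal claim fails. *)

(* Defs.v *)
From HB Require Import structures.
From mathcomp Require Import all_boot all_order all_algebra all_fingroup.
From mathcomp Require Import finmap.
From mathcomp Require Import boolp classical_sets cardinality reals trigo.

Set Implicit Arguments.
Unset Strict Implicit.
Unset Printing Implicit Defensive.

Import Order.TTheory GRing.Theory Num.Theory.

Local Open Scope ring_scope.

Section CoxeterSystem.

Definition coxeter_matrix (S : finType) (m : S -> S -> nat) : Prop :=
  [/\ forall s, m s s = 1%N,
      forall s t, m s t = m t s
    & forall s t, s != t -> (1 < m s t)%N].

(* [W] is the group presented by the generators [gen s], [s : S], and the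
   relations [(gen s * gen t) ^+ m s t = 1]: the relations hold, the generators
   generate, and every solution of the relations in a (possibly infinite) group
   extends to a morphism.  The order infinity cannot occur in a finite group,
   so that [m] takes its values in [nat]. *)
Definition coxeter_system (S : finType) (m : S -> S -> nat)
    (W : finGroupType) (gen : S -> W) : Prop :=
  [/\ coxeter_matrix m,
      <<[set gen s | s : S]>>%g = [set: W],
      forall s t, ((gen s * gen t) ^+ m s t = 1)%g
    & forall (H : groupType) (f : S -> H),
        (forall s t, ((f s * f t) ^+ m s t = 1)%g) ->
        exists2 phi : W -> H,
          {morph phi : x y / (x * y)%g} & forall s, phi (gen s) = f s].

End CoxeterSystem.

Section RootSystem.
Variables (R : realType) (S : finType) (m : S -> S -> nat).

Definition geom_space := {ffun S -> R^o}.

Definition simple_root (s : S) : geom_space := [ffun t => (t == s)%:R].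

Definition geom_form (v w : geom_space) : R :=
  \sum_s \sum_t v s * w t * - cos (pi / (m s t)%:R).

Definition simple_reflection (s : S) (v : geom_space) : geom_space :=
  v - (2 * geom_form v (simple_root s)) *: simple_root s.

(* An element of the group generated by [S] is a product [s_1 ... s_k], and it
   acts as the composite of the corresponding simple reflections. *)
Definition word_action (w : seq S) (v : geom_space) : geom_space :=
  foldr simple_reflection v w.

Definition is_root (v : geom_space) : Prop :=
  exists (w : seq S) (s : S), v = word_action w (simple_root s).

Definition is_positive_root (v : geom_space) : Prop :=
  is_root v /\ forall s, 0 <= v s.

(* [fset_set] is only meaningful on finite sets; there are finitely many roots
   when the Coxeter group is finite. *)
Definition positive_roots : {fset geom_space} :=
  fset_set [set v | is_positive_root v]%classic.

End RootSystem.

Section Matroid.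
Variable E : finType.

(* A matroid on a subset of [E]. The axioms are kept apart from the data, so
   that equality of matroids is equality of ground sets and of families of
   independent sets. *)
Record matroid := Matroid { ground : {set E}; indep : {set {set E}} }.

Definition matroid_axioms (M : matroid) : Prop :=
  [/\ forall I, I \in indep M -> I \subset ground M,
      finset.set0 \in indep M,
      forall I J : {set E}, I \subset J -> J \in indep M -> I \in indep M
    & forall I J : {set E}, I \in indep M -> J \in indep M -> (#|I| < #|J|)%N ->
        exists2 x, x \in J :\: I & x |: I \in indep M].

Definition rank (M : matroid) (A : {set E}) : nat :=
  (\max_(I in indep M | I \subset A) #|I|)%N.

Definition mclosure (M : matroid) (A : {set E}) : {set E} :=
  [set x in ground M | rank M (x |: A) == rank M A].

Definition flat (M : matroid) (F : {set E}) : bool := mclosure M F == F.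

Definition circuit (M : matroid) (C : {set E}) : bool :=
  minset (fun D : {set E} => (D \subset ground M) && (D \notin indep M)) C.

Definition in_common_circuit (M : matroid) : rel E :=
  [rel x y | [exists C : {set E}, [&& circuit M C, x \in C & y \in C]]].

(* [connect] is the reflexive transitive closure; reflexivity makes the coloops
   singleton components. *)
Definition components (M : matroid) : {set {set E}} :=
  [set [set y in ground M | connect (in_common_circuit M) x y]
     | x in ground M].

Definition mconnected (M : matroid) : Prop :=
  forall x y, x \in ground M -> y \in ground M ->
    connect (in_common_circuit M) x y.

Definition restriction (M : matroid) (A : {set E}) : matroid :=
  Matroid (ground M :&: A) [set I in indep M | I \subset A].

Definition basis_of_set (M : matroid) (A B : {set E}) : bool :=
  maxset (fun I : {set E} => (I \in indep M) && (I \subset A)) B.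

Definition contraction (M : matroid) (A : {set E}) : matroid :=
  Matroid (ground M :\: A)
    [set I : {set E} | (I \subset ground M :\: A) &&
       [exists B : {set E}, basis_of_set M A B && (I :|: B \in indep M)]].

Definition empty_matroid : matroid := Matroid finset.set0 [set finset.set0].

Definition direct_sum (M N : matroid) : matroid :=
  Matroid (ground M :|: ground N)
    [set I :|: J | I in indep M, J in indep N].

Definition flat_components (M : matroid) (F : {set E}) : {set {set E}} :=
  components (restriction M F).

Definition connected_flat (M : matroid) (F : {set E}) : Prop :=
  flat M F /\ mconnected (restriction M F).

Definition flat_join (M : matroid) (A : {set {set E}}) : {set E} :=
  mclosure M (\bigcup_(G in A) G).

Definition antichain (A : {set {set E}}) : Prop :=
  forall G H, G \in A -> H \in A -> G \subset H -> G = H.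

Definition nested (M : matroid) (N : {set {set E}}) : Prop :=
  (forall G, G \in N -> G != finset.set0 /\ connected_flat M G) /\
  (forall A : {set {set E}}, A \subset N -> antichain A -> (1 < #|A|)%N ->
     ~ mconnected (restriction M (flat_join M A))).

(* A flag is the sequence [:: F_0; F_1; ...; F_{k+1}], including the empty set
   [F_0] and the ground set [F_{k+1}]. *)
Definition flag_of_flats (M : matroid) (Fl : seq {set E}) : Prop :=
  [/\ head finset.set0 Fl = finset.set0, last finset.set0 Fl = ground M,
      sorted (fun A B : {set E} => A \proper B) Fl & all (flat M) Fl].

Definition flag_matroid (M : matroid) (Fl : seq {set E}) : matroid :=
  \big[direct_sum/empty_matroid]_(p <- zip Fl (behead Fl))
     contraction (restriction M p.2) p.1.

Definition flag_components (M : matroid) (Fl : seq {set E}) : {set {set E}} :=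
  \bigcup_(F <- behead Fl) flat_components M F.

End Matroid.

Section VectorMatroid.
Variables (K : fieldType) (V : vectType K) (E : finType) (f : E -> V).

Definition vector_matroid : matroid E :=
  Matroid [set: E] [set I : {set E} | free [seq f x | x <- enum I]].

Lemma vector_matroid_axioms : matroid_axioms vector_matroid.
Proof.
split=> [I _|||].
- exact: finset.subsetT.
- by rewrite !inE enum_set0 nil_free.
- move=> I J sIJ; rewrite !inE => freeJ.
  have pIJ : perm_eq (enum J) (enum I ++ enum (J :\: I)).
    apply: uniq_perm; first exact: enum_uniq.
      rewrite cat_uniq !enum_uniq andbT /=; apply/hasPn => x.
      by rewrite !mem_enum inE => /andP[].
    move=> x; rewrite mem_cat !mem_enum inE.
    by case: (boolP (x \in I)) => //= /(fintype.subsetP sIJ).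
  move: freeJ; rewrite (perm_free (perm_map f pIJ)) map_cat.
  exact: catl_free.
- move=> I J; rewrite !inE => freeI freeJ ltIJ.
  apply: contrapT => nox.
  suff sJI : (<<[seq f x | x <- enum J]>> <= <<[seq f x | x <- enum I]>>)%VS.
    have := dimvS sJI; move: freeI freeJ; rewrite /free => /eqP -> /eqP ->.
    by rewrite !size_map -!cardE leqNgt ltIJ.
  apply/span_subvP => _ /mapP[x xJ ->]; rewrite mem_enum in xJ.
  case: (boolP (x \in I)) => xI.
    by apply: memv_span; apply: map_f; rewrite mem_enum.
  apply: contrapT => /negP nspan; apply: nox; exists x; rewrite !inE ?xI //.
  have pxI : perm_eq (enum (x |: I)) (x :: enum I).
    apply: uniq_perm; first exact: enum_uniq.
      by rewrite /= mem_enum xI enum_uniq.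
    by move=> y; rewrite mem_enum !inE mem_enum.
  by rewrite (perm_free (perm_map f pxI)) /= free_cons nspan.
Qed.

End VectorMatroid.

Section Bergman.
Variables (R : realType) (E : finType).
Implicit Types (M : matroid E) (w : {ffun E -> R}) (Fl : seq {set E}).

Definition level_flag w : seq {set E} :=
  finset.set0 :: [seq [set x | w x <= t] | t <- sort <=%R (undup (codom w))].

Definition is_level_flag w Fl : Prop :=
  let F := nth finset.set0 Fl in
  [/\ (0 < size Fl)%N, F 0%N = finset.set0, last finset.set0 Fl = [set: E],
      sorted (fun A B : {set E} => A \proper B) Fl &
      (forall i, (i.+1 < size Fl)%N ->
         {in F i.+1 :\: F i &, forall x y, w x = w y}) /\
      (forall i, (i.+2 < size Fl)%N ->
         {in F i.+1 :\: F i & F i.+2 :\: F i.+1, forall x y, w x < w y})].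

Lemma is_level_flag_layer w Fl : is_level_flag w Fl ->
  forall x, exists2 i, (i.+1 < size Fl)%N &
    x \in nth finset.set0 Fl i.+1 :\: nth finset.set0 Fl i.
Proof.
move=> [Fl_gt0 F0 Flast _ _] x.
have exi : exists i, x \in nth finset.set0 Fl i.
  by exists (size Fl).-1; rewrite nth_last Flast inE.
case: (ex_minnP exi) => -[|i]; first by rewrite F0 inE.
move=> xi mini; exists i.
  by rewrite ltnNge; apply/negP => ?; move: xi; rewrite nth_default ?inE.
by rewrite inE xi andbT; apply/negP => /mini; rewrite ltnn.
Qed.

Lemma is_level_flag_lt w Fl : is_level_flag w Fl ->
  forall i j, (i < j)%N -> (j.+1 < size Fl)%N ->
  {in nth finset.set0 Fl i.+1 :\: nth finset.set0 Fl i &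
      nth finset.set0 Fl j.+1 :\: nth finset.set0 Fl j,
    forall x y, w x < w y}.
Proof.
move=> [_ _ _ Fsort [_ Flt]] i j; elim: j => // j IHj.
rewrite ltnS leq_eqVlt => /orP[/eqP -> | ltij] ltj x y xi yj; first exact: Flt yj.
have /properP[_ [z zj zNj]] :
    nth finset.set0 Fl j \proper nth finset.set0 Fl j.+1.
  by apply: (sortedP _ Fsort); apply: ltnW.
have zl : z \in nth finset.set0 Fl j.+1 :\: nth finset.set0 Fl j.
  by rewrite inE zj zNj.
apply: (@lt_trans _ _ (w z)); first exact: (IHj ltij (ltnW ltj)).
exact: (Flt j ltj).
Qed.

Lemma is_level_flag_sublevel w Fl : is_level_flag w Fl ->
  forall i e, (i.+1 < size Fl)%N ->
    e \in nth finset.set0 Fl i.+1 :\: nth finset.set0 Fl i ->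
    nth finset.set0 Fl i.+1 = [set x | w x <= w e].
Proof.
move=> Flw i e lti ei.
have := Flw; move=> [_ _ _ Fsort [Feq _]].
have Fmono a b : (a <= b)%N -> (b < size Fl)%N ->
    nth finset.set0 Fl a \subset nth finset.set0 Fl b.
  elim: b => [|b IHb]; first by rewrite leqn0 => /eqP ->.
  rewrite leq_eqVlt => /orP[/eqP -> // | ltab] ltb.
  apply: (fintype.subset_trans (IHb ltab (ltnW ltb))).
  by apply: proper_sub; apply: (sortedP _ Fsort).
apply/finset.setP => x; rewrite [RHS]inE.
have [j ltj xj] := is_level_flag_layer Flw x.
case: (ltngtP i j) => [ltij | ltji | eqij].
- rewrite leNgt (is_level_flag_lt Flw ltij ltj ei xj) /=.
  apply/negP => xi; move: xj; rewrite inE => /andP[/negP[]].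
  by apply: fintype.subsetP xi; apply: Fmono => //; apply: ltnW.
- rewrite (ltW (is_level_flag_lt Flw ltji lti xj ei)).
  move: xj; rewrite inE => /andP[_].
  by apply: fintype.subsetP; apply: Fmono => //; apply: ltnW.
- rewrite -{}eqij in ltj xj.
  rewrite (Feq i lti x e xj ei) lexx.
  by move: xj; rewrite inE => /andP[].
Qed.

Lemma level_flag_spec w : is_level_flag w (level_flag w).
Proof.
pose ts := sort <=%R (undup (codom w)).
have mem_ts x : w x \in ts by rewrite mem_sort mem_undup codom_f.
have ts_sorted : sorted <%R ts.
  by rewrite sort_lt_sorted undup_uniq.
have ts_lt i j : (i < j)%N -> (j < size ts)%N -> ts`_i < ts`_j.
  move=> ltij ltj; apply: (sorted_ltn_nth lt_trans) => //.
  by rewrite inE; apply: ltn_trans ltij ltj.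
have tsP i : (i < size ts)%N -> exists x, ts`_i = w x.
  move=> lti; have := mem_nth 0 lti; rewrite mem_sort mem_undup.
  by move=> /codomP[x ->]; exists x.
have FE i : (i < size ts)%N ->
    nth finset.set0 (level_flag w) i.+1 = [set x | w x <= ts`_i].
  by move=> lti; rewrite /= (nth_map 0).
have layer i x : (i < size ts)%N ->
    x \in nth finset.set0 (level_flag w) i.+1
           :\: nth finset.set0 (level_flag w) i -> w x = ts`_i.
  move=> lti; rewrite inE FE // inE.
  have jlt : (index (w x) ts < size ts)%N by rewrite index_mem.
  have jE := nth_index 0 (mem_ts x).
  case: (ltngtP (index (w x) ts) i) => [ltji | ltij | <-]; last by rewrite jE.
    case: i ltji lti => // i; rewrite ltnS => leji lti.
    rewrite FE ?inE; last exact: ltnW.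
    move: leji; rewrite leq_eqVlt => /orP[/eqP eqji | ltji].
      by rewrite -eqji jE lexx.
    by rewrite -jE ltW // ts_lt // ltnW.
  have := ts_lt _ _ ltij jlt; rewrite jE ltNge => /negbTE ->.
  by rewrite andbF.
have sz : size (level_flag w) = (size ts).+1 by rewrite /= size_map.
split=> //.
- rewrite -nth_last sz /=.
  have [ts0 | ts_gt0] := posnP (size ts).
    apply/finset.setP => x; have := mem_ts x.
    by rewrite (size0nil ts0).
  rewrite -[size ts]prednK // FE ?prednK //.
  apply/finset.setP => x; rewrite !inE.
  rewrite -(nth_index 0 (mem_ts x)).
  have: (index (w x) ts < size ts)%N by rewrite index_mem.
  rewrite -{1}(prednK ts_gt0) ltnS leq_eqVlt => /orP[/eqP -> | lti].
    by rewrite lexx.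
  by rewrite ltW // ts_lt // prednK.
- apply/(sortedP finset.set0) => i; rewrite sz ltnS => lti.
  have [x xE] := tsP i lti.
  apply/properP; split.
    apply/fintype.subsetP => y; case: i lti {x xE} => [|i] lti; first by rewrite inE.
    rewrite !FE ?inE // 1?ltnW // => /le_trans; apply; apply: ltW.
    exact: ts_lt.
  exists x; first by rewrite FE // inE xE.
  case: i lti xE => [|i] lti xE; first by rewrite inE.
  rewrite FE ?inE 1?ltnW // -xE -ltNge; exact: ts_lt.
- split=> i; rewrite sz ltnS => lti x y.
    by move=> /(layer _ _ lti) -> /(layer _ _ lti) ->.
  move=> /(layer _ _ (ltnW lti)) -> /(layer _ _ lti) ->; exact: ts_lt.
Qed.

Lemma level_flagP w Fl : is_level_flag w Fl <-> Fl = level_flag w.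
Proof.
split=> [Flw | ->]; last exact: level_flag_spec.
have sub Fl1 Fl2 : is_level_flag w Fl1 -> is_level_flag w Fl2 ->
    {subset Fl1 <= Fl2}.
  move=> Fw1 Fw2 A /(nthP finset.set0)[[|i] lti <-].
    have [_ -> _ _ _] := Fw1; have [Fl2_gt0 <- _ _ _] := Fw2.
    exact: mem_nth.
  have [_ _ _ Fsort _] := Fw1.
  have /properP[_ [e ei eNi]] := sortedP finset.set0 Fsort i lti.
  have el : e \in nth finset.set0 Fl1 i.+1 :\: nth finset.set0 Fl1 i.
    by rewrite inE ei eNi.
  have [j ltj ej] := is_level_flag_layer Fw2 e.
  rewrite (is_level_flag_sublevel Fw1 lti el).
  by rewrite -(is_level_flag_sublevel Fw2 ltj ej) mem_nth.
have Fw := level_flag_spec w.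
have [_ _ _ sort1 _] := Flw; have [_ _ _ sort2 _] := Fw.
apply: (irr_sorted_eq _ _ sort1 sort2).
- by move=> B A C; apply: fintype.proper_trans.
- by move=> A; rewrite fintype.properxx.
- by move=> A; apply/idP/idP; apply: sub.
Qed.

Definition unit_sphere : set {ffun E -> R} :=
  [set w | \sum_x w x = 0 /\ \sum_x w x ^+ 2 = 1]%classic.

Definition bergman M : set {ffun E -> R} :=
  [set w | unit_sphere w /\ flag_of_flats M (level_flag w)]%classic.

Definition coarse_cell M (N : matroid E) : set {ffun E -> R} :=
  [set w | bergman M w /\ flag_matroid M (level_flag w) = N]%classic.

Definition coarse_subdivision M : set (set {ffun E -> R}) :=
  [set C | C <> set0 /\ exists N, C = coarse_cell M N]%classic.

Definition nested_cell M (N : {set {set E}}) : set {ffun E -> R} :=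
  [set w | bergman M w /\ flag_components M (level_flag w) = N]%classic.

(* When [M] is connected, the nested set consisting of the ground set only is
   the empty face of the complex and contributes no cell. *)
Definition nested_set_complex M : set (set {ffun E -> R}) :=
  [set C | C <> set0 /\ exists N : {set {set E}},
     [/\ nested M N, components M \subset N & C = nested_cell M N]]%classic.

(* The vectors that can be added to a point without changing its cell. This is
   the zero space when [M] is connected. *)
Definition lineality M : set {ffun E -> R} :=
  [set l | \sum_x l x = 0 /\
     forall G, G \in components M -> {in G &, forall x y, l x = l y}]%classic.

Definition open_simplex (L : set {ffun E -> R}) (T : finType)
    (u : T -> {ffun E -> R}) (sigma : {set T}) : set {ffun E -> R} :=
  [set w | unit_sphere w /\ exists (l : {ffun E -> R}) (a : T -> R),
     [/\ L l, forall v, v \in sigma -> 0 < a v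
       & forall x, w x = l x + \sum_(v in sigma) a v * u v x]]%classic.

(* The cells in [D] are the open simplices of a spherical geometric simplicial
   complex with vertices [u v] and abstract simplicial complex [K], up to the
   linear space [L]; for [L = 0] this is a simplicial complex in the sphere,
   in which the face [set0] of [K] has no points. *)
Definition simplicial_complex_mod (L : set {ffun E -> R})
    (D : set (set {ffun E -> R})) : Prop :=
  exists (T : finType) (u : T -> {ffun E -> R}) (K : {set {set T}}),
    (finset.set0 \in K /\
     forall sigma tau : {set T}, tau \subset sigma -> sigma \in K -> tau \in K) /\
    [/\ forall v, unit_sphere (u v),
        forall (sigma : {set T}) (a : T -> R) (l : {ffun E -> R}),
          sigma \in K -> L l ->
          (forall x, \sum_(v in sigma) a v * u v x = l x) ->
          forall v, v \in sigma -> a v = 0,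
        forall (sigma tau : {set T}) (w : {ffun E -> R}),
          sigma \in K -> tau \in K ->
          open_simplex L u sigma w -> open_simplex L u tau w -> sigma = tau
      & forall C, D C <-> C <> set0%classic /\
          exists2 sigma, sigma \in K & C = open_simplex L u sigma].

End Bergman.

Arguments coarse_subdivision R {E} M.
Arguments nested_set_complex R {E} M.
Arguments lineality R {E} M.

Definition root_matroid (R : realType) (S : finType) (m : S -> S -> nat) :
    matroid (positive_roots R m) :=
  vector_matroid (fun x : positive_roots R m => \val x).

(* Main.v *)
(* An average of the standard inner product over the finite group [W] is an
   invariant inner product on the geometric representation.  Since reflections
   map roots to roots, two non-orthogonal roots lie in a circuit with a third
   one, hence the connected components of a flat are its components for
   non-orthogonality.

   Given a weight [w] whose sublevel sets are flats, let [wcomp w x] be the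
   component of [x] in the sublevel set [{w <= w x}], and let [wtop w x] be the
   part of it on which [w] takes the value [w x].  The set [N(F(w))] consists of
   all [wcomp w x], and [M_{F(w)}] is the direct sum of the contractions of the
   flats [wcomp w x] by the union of the smaller members of [N(F(w))]; thus
   [N(F(w))] determines [M_{F(w)}].  Conversely, by a reflection argument, each
   of these summands, with ground set [wtop w x], is connected, so that [M_{F(w)}]
   determines the sets [wtop w x]; and [wcomp w x] is the closure of [wtop w x],
   because a root of [wcomp w x] outside this closure would be orthogonal to it.

   For a nested set [N] containing the components of [M], the weights with
   [N(F(w)) = N] are exactly those of the form [l - sum_G a_G 1_G], with [l]
   constant on the components of [M], [G] in [N] not a component, and [a_G > 0];
   the functions [1_G] are linearly independent modulo such [l]. *)
Require Import Defs.
From HB Require Import structures.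
From mathcomp Require Import all_boot all_order all_algebra all_fingroup.
From mathcomp Require Import finmap.
From mathcomp Require Import boolp reals trigo.
From mathcomp Require Import ring lra zify.
Set Implicit Arguments.
Unset Strict Implicit.
Unset Printing Implicit Defensive.
Import Order.TTheory GRing.Theory Num.Theory.
Local Open Scope ring_scope.

(** The averaged form is positive definite by construction, which is not known at the outset for the
    geometric form. Against a simple root the two forms are proportional, so the simple reflections
    are orthogonal reflections for the averaged form too.

    The third root of a circuit must belong to the ground set, that is, be positive. This rests on
    the theorem that every root is positive or negative, proved by induction on word length with the
    dihedral subgroups as the only explicit computation.

    The reflection argument behind the summands is this. If a root [k] on top of a component is not
    orthogonal to a lower root [d], their third root cannot be lower, since [k] would then lie in
    the flat of lower roots. So it is again on top, and parallel to [k] modulo the lower roots. This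
    one fact shows both that the top part spans the component and that its contraction is
    connected. *)

(** * Spans, flats and contractions in the matroid of a vector configuration *)

Section VectorConfiguration.
Variables (K : fieldType) (V : vectType K) (E : finType) (f : E -> V).
Implicit Types (A B C D F I J X : {set E}) (U : {vspace V}).
Local Notation M := (vector_matroid f).

Definition lspan A : {vspace V} := (\sum_(x in A) <[f x]>)%VS.

Definition comb A (c : E -> K) : V := \sum_(x in A) c x *: f x.

Lemma lspanP A v : reflect (exists c, v = comb A c) (v \in lspan A).
Proof.
apply: (iffP idP) => [/memv_sumP[u uA ->]|[c ->]]; last first.
  by apply: memv_sumr => x xA; apply: memvZ; apply: memv_line.
have /choice[c cP] : forall x, exists k, x \in A -> u x = k *: f x.
  move=> x; case: (boolP (x \in A)) => [/uA/vlineP[k ->]|_]; last by exists 0.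
  by exists k.
by exists c; apply: eq_bigr => x /cP.
Qed.

Lemma comb_lspan A c : comb A c \in lspan A.
Proof. by apply/lspanP; exists c. Qed.

Lemma mem_lspan A x : x \in A -> f x \in lspan A.
Proof. by move=> xA; apply: (subvP (sumv_sup x xA (subvv _))); apply: memv_line. Qed.

Lemma lspan_sub A U : (forall x, x \in A -> f x \in U) -> (lspan A <= U)%VS.
Proof. by move=> AU; apply/subv_sumP => x /AU; rewrite memvE. Qed.

Lemma lspanS A B : A \subset B -> (lspan A <= lspan B)%VS.
Proof. by move=> /subsetP sAB; apply: lspan_sub => x /sAB/mem_lspan. Qed.

Lemma lspanU A B : lspan (A :|: B) = (lspan A + lspan B)%VS.
Proof.
apply/eqP; rewrite eqEsubv subv_add !lspanS ?subsetUl ?subsetUr // !andbT.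
apply: lspan_sub => x; rewrite inE => /orP[] /mem_lspan xA.
  exact: (subvP (addvSl _ _)).
exact: (subvP (addvSr _ _)).
Qed.

Lemma eq_comb A c d : {in A, c =1 d} -> comb A c = comb A d.
Proof. by move=> cd; apply: eq_bigr => x /cd ->. Qed.

Lemma combU A B c : [disjoint A & B] -> comb (A :|: B) c = comb A c + comb B c.
Proof.
move=> dAB; rewrite /comb (big_setID A) /= setUK setDUl setDv set0U.
by rewrite (setDidPl _) // disjoint_sym.
Qed.

Lemma combI A B c : comb A c = comb (A :&: B) c + comb (A :\: B) c.
Proof. by rewrite /comb (big_setID B). Qed.

Lemma comb1 x c : comb [set x] c = c x *: f x.
Proof. by rewrite /comb big_set1. Qed.

(** Linear independence of the family in the quotient [V / U]. Contractions are then governed by the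
    span of the contracted set, with no choice of basis. *)
Definition indep_mod U A : Prop :=
  forall c, comb A c \in U -> {in A, forall x, c x = 0}.

Lemma indep_modS U A B : A \subset B -> indep_mod U B -> indep_mod U A.
Proof.
move=> /subsetP sAB iB c cA x xA.
have := iB (fun y => if y \in A then c y else 0) _ x (sAB x xA).
rewrite xA; apply.
rewrite (combI _ A) (setIidPr _); last exact/subsetP.
rewrite (eq_comb (d := c)) => [|y -> //]; rewrite {2}/comb big1 ?addr0 //.
by move=> y; rewrite inE => /andP[/negbTE -> _]; rewrite scale0r.
Qed.

Lemma indep_modW U U' A : (U <= U')%VS -> indep_mod U' A -> indep_mod U A.
Proof. by move=> /subvP sUU iA c /sUU/iA. Qed.

Lemma indep_mod1 U x : indep_mod U [set x] <-> f x \notin U.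
Proof.
split=> [ix | nx c].
  apply/negP => xU; have := oner_neq0 K; rewrite -(ix (fun=> 1) _ x) ?eqxx //.
    by rewrite comb1 scale1r.
  by rewrite inE.
rewrite comb1 => cU y; rewrite inE => /eqP ->.
by apply: contraNeq nx => c0; move: cU; rewrite rpredZeq (negbTE c0).
Qed.

Lemma indep_modU1 U A x : x \notin A ->
  indep_mod U (x |: A) <-> indep_mod U A /\ f x \notin (U + lspan A)%VS.
Proof.
move=> xA; have dx : [disjoint [set x] & A] by rewrite disjoints1.
split=> [iA | [iA nx] c].
  split; first exact: indep_modS (subsetUr _ _) iA.
  apply/negP => /memv_addP[u uU [v /lspanP[c ->] xE]].
  suff /iA/(_ x (setU11 _ _))/eqP :
      comb (x |: A) (fun y => if y == x then 1 else - c y) \in U.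
    by rewrite eqxx oner_eq0.
  rewrite combU // comb1 eqxx scale1r xE.
  suff -> : comb A (fun y => if y == x then 1 else - c y) = - comb A c.
    by rewrite addrK.
  rewrite /comb -sumrN; apply: eq_bigr => y yA; case: eqP => [yx|_].
    by rewrite -yx yA in xA.
  by rewrite scaleNr.
rewrite combU // comb1 => cU.
have cx : c x = 0.
  apply: contraNeq nx => c0.
  suff : c x *: f x \in (U + lspan A)%VS by rewrite rpredZeq (negbTE c0).
  apply/memv_addP; exists (c x *: f x + comb A c) => //.
  by exists (- comb A c); rewrite ?addrK // memvN comb_lspan.
move: cU; rewrite cx scale0r add0r => /iA cA y.
by rewrite !inE => /orP[/eqP ->|/cA].
Qed.

Lemma indep_mod_comb U A B c :
  indep_mod U (A :|: B) -> [disjoint A & B] -> comb A c \in (U + lspan B)%VS ->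
  {in A, forall x, c x = 0}.
Proof.
move=> iAB dAB /memv_addP[u uU [_ /lspanP[d ->] cE]] x xA.
have := iAB (fun y => if y \in B then - d y else c y) _ x.
rewrite inE xA /= (disjointFr dAB xA) => /(_ _ isT); apply.
rewrite combU // (@eq_comb A _ c); last by move=> y yA; rewrite (disjointFr dAB yA).
rewrite (@eq_comb B _ (fun y => - d y)); last by move=> y ->.
rewrite cE -addrA -big_split /= big1 ?addr0 // => y _.
by rewrite scaleNr subrr.
Qed.

Lemma indep_modU U A B : [disjoint A & B] ->
  indep_mod U (A :|: B) <-> indep_mod (U + lspan B)%VS A /\ indep_mod U B.
Proof.
move=> dAB; split=> [iAB | [iA iB] c].
  split; last exact: indep_modS (subsetUr _ _) iAB.
  by move=> c cA; apply: indep_mod_comb iAB dAB cA.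
rewrite combU // => cU.
have cA : {in A, forall x, c x = 0}.
  apply: iA; apply/memv_addP; exists (comb A c + comb B c) => //.
  by exists (- comb B c); rewrite ?addrK // memvN comb_lspan.
have cB : {in B, forall x, c x = 0}.
  apply: iB; move: cU; rewrite (@eq_comb A _ (fun=> 0)) //.
  by rewrite {1}/comb big1 ?add0r // => x _; rewrite scale0r.
by move=> x; rewrite inE => /orP[/cA|/cB].
Qed.

Lemma indep_vectorP A : reflect (indep_mod 0 A) (A \in indep M).
Proof.
rewrite inE /=.
have sz : size [seq f x | x <- enum A] = #|A| by rewrite size_map cardE.
have xnth (x : 'I_#|A|) : [seq f x | x <- enum A]`_x = f (enum_val x).
  by rewrite (nth_map (enum_default x)) // -cardE.
pose t := [tuple f (enum_val i) | i < #|A|].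
have -> : free [seq f x | x <- enum A] = free t.
  suff -> : [seq f x | x <- enum A] = t :> seq V by [].
  apply: (@eq_from_nth _ 0); rewrite sz ?size_tuple // => i lti.
  by rewrite (xnth (Ordinal lti)) -(tnth_nth 0 t (Ordinal lti)) tnth_mktuple.
have tE c : comb A c = \sum_(i < #|A|) c (enum_val i) *: t`_i.
  rewrite /comb big_enum_val; apply: eq_bigr => i _.
  by rewrite -tnth_nth tnth_mktuple.
apply: (iffP (@freeP _ _ _ t)) => [ft c | iA k].
  rewrite memv0 tE => /eqP /ft c0 x xA.
  by have := c0 (enum_rank_in xA x); rewrite enum_rankK_in.
move=> kE i; have x0A := enum_valP i.
have := iA (fun x => k (enum_rank_in x0A x)) _ (enum_val i) (enum_valP i).
rewrite enum_valK_in; apply; rewrite memv0 tE; apply/eqP.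
by rewrite -[RHS]kE; apply: eq_bigr => j _; rewrite enum_valK_in.
Qed.

Lemma lspan_enum A : lspan A = <<[seq f x | x <- enum A]>>%VS.
Proof.
apply/eqP; rewrite eqEsubv; apply/andP; split.
  by apply: lspan_sub => x xA; apply: memv_span; apply: map_f; rewrite mem_enum.
apply/span_subvP => _ /mapP[x xA ->]; apply: mem_lspan.
by rewrite mem_enum in xA.
Qed.

Lemma dim_indep A : A \in indep M -> \dim (lspan A) = #|A|.
Proof. by rewrite inE lspan_enum /= => /eqP ->; rewrite size_map cardE. Qed.

Lemma exists_basis A : exists B, [/\ B \in indep M, B \subset A &
  maxset (fun I => (I \in indep M) && (I \subset A)) B].
Proof.
have P0 : (fun I => (I \in indep M) && (I \subset A)) set0.
  by rewrite sub0set andbT; apply/indep_vectorP => c _ x; rewrite inE.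
have [B maxB _] := maxset_exists (P := fun I => (I \in indep M) && (I \subset A)) P0.
by have /andP[BM BA] := maxsetp maxB; exists B.
Qed.

Lemma lspan_basis A B :
  maxset (fun I => (I \in indep M) && (I \subset A)) B -> lspan B = lspan A.
Proof.
move=> maxB; have /andP[/indep_vectorP iB BA] := maxsetp maxB.
apply/eqP; rewrite eqEsubv lspanS //=; apply: lspan_sub => x xA.
have [xB|xB] := boolP (x \in B); first exact: mem_lspan.
apply/negPn/negP => nx.
have xBM : (x |: B \in indep M) && (x |: B \subset A).
  rewrite subUset sub1set xA BA !andbT; apply/indep_vectorP/indep_modU1 => //.
  by rewrite add0v.
have := maxsetsup maxB xBM (subsetUr _ _) => /setP /(_ x).
by rewrite setU11 (negbTE xB).
Qed.

Lemma rank_vector A : rank M A = \dim (lspan A).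
Proof.
apply/eqP; rewrite /rank eqn_leq; apply/andP; split.
  by apply/bigmax_leqP => I /andP[/dim_indep <- IA]; apply: dimvS; apply: lspanS.
have [B [iB BA /lspan_basis <-]] := exists_basis A.
by rewrite dim_indep //; apply: (leq_bigmax_cond _ (F := fun I => #|I|)); rewrite iB.
Qed.

Lemma mem_mclosure A x : (x \in mclosure M A) = (f x \in lspan A).
Proof.
rewrite inE in_setT /= !rank_vector eq_sym.
rewrite (dimv_leqif_sup (lspanS (subsetUr _ _))) lspanU subv_add subvv andbT.
by rewrite {1}/lspan big_set1 -memvE.
Qed.

Lemma flatP F : reflect (forall x, f x \in lspan F -> x \in F) (flat M F).
Proof.
apply: (iffP eqP) => [clF x|Fx]; first by rewrite -{2}clF mem_mclosure.
apply/setP => x; rewrite mem_mclosure; apply/idP/idP; first exact: Fx.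
exact: mem_lspan.
Qed.

Lemma lspan_mclosure A : lspan (mclosure M A) = lspan A.
Proof.
apply/eqP; rewrite eqEsubv; apply/andP; split.
  by apply: lspan_sub => x; rewrite mem_mclosure.
by apply: lspanS; apply/subsetP => x xA; rewrite mem_mclosure mem_lspan.
Qed.

Lemma flat_mclosure A : flat M (mclosure M A).
Proof. by apply/flatP => x; rewrite lspan_mclosure mem_mclosure. Qed.

Lemma subset_mclosure A : A \subset mclosure M A.
Proof. by apply/subsetP => x xA; rewrite mem_mclosure mem_lspan. Qed.

Lemma mclosure_flat F A : flat M F -> A \subset F -> mclosure M A \subset F.
Proof.
move=> /flatP flF AF; apply/subsetP => x; rewrite mem_mclosure => xA.
by apply: flF; apply: (subvP (lspanS AF)).
Qed.

(** A basis [B] of [A] has the same span as [A], so independence of [I :|: B] is independence of [I]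
    modulo [lspan A], whichever basis is chosen. *)
Lemma indep_contractionP A F I : A \subset F ->
  reflect (I \subset F :\: A /\ indep_mod (lspan A) I)
          (I \in indep (contraction (restriction M F) A)).
Proof.
move=> AF; rewrite inE /= setTI.
have basisE B : basis_of_set (restriction M F) A B =
    maxset (fun J => (J \in indep M) && (J \subset A)) B.
  apply: maxset_eq => J; rewrite inE /= -andbA; congr (_ && _).
  by rewrite andb_idl // => /subset_trans; apply.
have disjB B : B \subset A -> I \subset F :\: A -> [disjoint I & B].
  move=> BA; rewrite subsetD => /andP[_]; exact: disjointWr.
apply: (iffP andP) => -[sI].
  move=> /existsP[B /andP[]]; rewrite basisE => maxB; rewrite inE => /andP[].
  move=> /indep_vectorP; have /andP[_ BA] := maxsetp maxB.
  by move/(indep_modU _ (disjB B BA sI)); rewrite add0v (lspan_basis maxB) => -[].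
move=> iI; split=> //; apply/existsP.
have [B [iB BA maxB]] := exists_basis A; exists B; rewrite basisE maxB inE /=.
apply/andP; split; last first.
  rewrite subUset (subset_trans BA AF) andbT.
  by apply: subset_trans sI _; apply: subsetDl.
apply/indep_vectorP/(indep_modU _ (disjB B BA sI)).
by rewrite add0v (lspan_basis maxB); split=> //; apply/indep_vectorP.
Qed.

End VectorConfiguration.

(** * Independent sets of iterated direct sums *)

Section DirectSum.
Variables (E : finType) (T : eqType) (N : T -> matroid E).
Hypothesis indep_sub : forall p I, I \in indep (N p) -> I \subset ground (N p).
Local Notation sum r := (\big[@direct_sum E/empty_matroid E]_(p <- r) N p).

Lemma ground_direct_sum (r : seq T) x :
  (x \in ground (sum r)) = has (fun p => x \in ground (N p)) r.
Proof.
elim: r => [|p r IHr]; first by rewrite big_nil inE.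
by rewrite big_cons /= inE IHr.
Qed.

(** Disjointness of the ground sets lets the part of [I] in each summand be recovered as a trace. *)
Lemma indep_direct_sum (r : seq T) I :
  pairwise (fun p q => [disjoint ground (N p) & ground (N q)]) r ->
  I \in indep (sum r) <->
  I \subset ground (sum r) /\ {in r, forall p, I :&: ground (N p) \in indep (N p)}.
Proof.
elim: r I => [|p r IHr] I.
  rewrite big_nil /= inE subset0 => _; split=> [->|[]//].
  by split.
rewrite pairwise_cons => /andP[/allP dp dr].
have dis (A : {set E}) : A \subset ground (sum r) -> A :&: ground (N p) = set0.
  move=> /subsetP Ar; apply/setP => x; rewrite !inE; apply/negP => /andP[/Ar].
  rewrite ground_direct_sum => /hasP[q qr xq] xp.
  by have := disjointFr (dp q qr) xp; rewrite xq.
rewrite big_cons /=; split.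
  move=> /imset2P[J L Jp /(IHr _ dr)[Lr LN] ->]; split.
    by rewrite setUSS // indep_sub.
  move=> q; rewrite inE setIUl => /orP[/eqP ->|qr].
    by rewrite (dis L Lr) setU0 (setIidPl (indep_sub Jp)).
  suff -> : J :&: ground (N q) = set0 by rewrite set0U LN.
  apply/disjoint_setI0; apply: disjointWl (dp q qr); exact: indep_sub.
move=> [sI IN]; apply/imset2P.
exists (I :&: ground (N p)) (I :&: ground (sum r)).
- by apply: IN; rewrite mem_head.
- apply/(IHr _ dr); rewrite subsetIr; split=> // q qr.
  have qs : ground (N q) \subset ground (sum r).
    by apply/subsetP => x xq; rewrite ground_direct_sum; apply/hasP; exists q.
  by rewrite -setIA (setIidPr qs); apply: IN; rewrite inE qr orbT.
- by rewrite -setIUr (setIidPl sI).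
Qed.

End DirectSum.

(** * The matroid of a level flag in terms of sublevel sets *)

Section FlagMatroid.
Variables (R : realType) (V : vectType R) (E : finType) (f : E -> V).
Variable w : {ffun E -> R}.
Local Notation M := (vector_matroid f).

Definition sublevel (t : R) : {set E} := [set x | w x <= t].
Definition strict_sublevel (t : R) : {set E} := [set x | w x < t].
Definition level (t : R) : {set E} := [set x | w x == t].

Lemma strict_sublevelS t : strict_sublevel t \subset sublevel t.
Proof. by apply/subsetP => x; rewrite !inE => /ltW. Qed.

Lemma sublevelD t : sublevel t :\: strict_sublevel t = level t.
Proof. by apply/setP => x; rewrite !inE -leNgt eq_le andbC. Qed.

Lemma mem_level_values t :
  reflect (exists x, t = w x) (t \in sort <=%R (undup (codom w))).
Proof.
rewrite mem_sort mem_undup; apply: (iffP codomP) => -[x ->]; by exists x.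
Qed.

(** Consecutive terms of the level flag are the strict and the full sublevel set at one value of
    [w]; at the least value the strict one is the leading empty set. *)
Lemma flag_matroid_levels : flag_matroid M (level_flag w) =
  \big[@direct_sum E/empty_matroid E]_(t <- sort <=%R (undup (codom w)))
     contraction (restriction M (sublevel t)) (strict_sublevel t).
Proof.
pose ts := sort <=%R (undup (codom w)).
have ts_sorted : sorted <%R ts by rewrite sort_lt_sorted undup_uniq.
have ts_lt i j : (i < j)%N -> (j < size ts)%N -> ts`_i < ts`_j.
  move=> ltij ltj; apply: (sorted_ltn_nth lt_trans) => //.
  by rewrite inE; apply: ltn_trans ltij ltj.
have index_w x : (index (w x) ts < size ts)%N /\ ts`_(index (w x) ts) = w x.
  have wx : w x \in ts by apply/mem_level_values; exists x.
  by rewrite index_mem nth_index.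
rewrite /flag_matroid; set z := zip _ _.
suff -> : z = [seq (strict_sublevel t, sublevel t) | t <- ts] by rewrite big_map.
have szz : size z = size ts.
  by rewrite size_zip /= size_map; apply/minn_idPr; apply: leqnSn.
apply: (@eq_from_nth _ (set0, set0)); rewrite ?szz ?size_map // => i lti.
rewrite (nth_map 0) // nth_zip_cond szz lti /= (nth_map 0) //.
congr (_, _).
case: i lti => [|i] lti.
  apply/esym/setP => x; rewrite !inE; apply/negbTE; rewrite -leNgt.
  have [ltx <-] := index_w x; case: (index _ _) ltx => // j ltj.
  by apply: ltW; apply: ts_lt.
rewrite /= (nth_map 0) ?(ltnW lti) //; apply/setP => x; rewrite !inE.
have [ltx <-] := index_w x; set j := index _ _ in ltx *.
have [leji | ltij] := leqP j i.
  rewrite (ts_lt j) //; move: leji; rewrite leq_eqVlt => /orP[/eqP ->|ltji].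
    by rewrite lexx.
  by rewrite ltW // ts_lt // ltnW.
have le2 : ts`_i.+1 <= ts`_j.
  move: ltij; rewrite leq_eqVlt => /orP[/eqP <-|ltij]; first by rewrite lexx.
  by apply: ltW; apply: ts_lt.
by rewrite -/ts [LHS]leNgt (ts_lt i j) // ltNge le2.
Qed.

Lemma ground_flag_matroid : ground (flag_matroid M (level_flag w)) = setT.
Proof.
rewrite flag_matroid_levels; apply/setP => x; rewrite inE ground_direct_sum.
apply/hasP; exists (w x); first by apply/mem_level_values; exists x.
by rewrite /= setTI sublevelD inE.
Qed.

Lemma indep_flag_matroidP I :
  I \in indep (flag_matroid M (level_flag w)) <->
  forall x, indep_mod f (lspan f (strict_sublevel (w x))) (I :&: level (w x)).
Proof.
rewrite flag_matroid_levels; rewrite indep_direct_sum.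
- rewrite -flag_matroid_levels ground_flag_matroid subsetT.
  split=> [[_ iI] x | iI].
    have /iI : w x \in sort <=%R (undup (codom w)).
      by apply/mem_level_values; exists x.
    rewrite [ground _]/= setTI sublevelD.
    by move=> /(indep_contractionP _ _ (strict_sublevelS _))[].
  split=> // _ /mem_level_values[x ->]; rewrite [ground _]/= setTI sublevelD.
  apply/indep_contractionP; first exact: strict_sublevelS.
  by rewrite sublevelD subsetIr.
- move=> t J /(indep_contractionP _ _ (strict_sublevelS _))[] + _.
  by rewrite [ground _]/= setTI.
- apply: sub_pairwise (_ : pairwise (fun s t => s != t) _).
    move=> s t st; rewrite /= !setTI !sublevelD -setI_eq0; apply/eqP/setP => x.
    by rewrite !inE; apply/negP => /andP[/eqP-> /eqP]; apply/eqP.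
  by rewrite -uniq_pairwise sort_uniq undup_uniq.
Qed.

End FlagMatroid.

(** * Orthogonality components of flats, and their agreement with matroid components *)

Section RootConfiguration.
Variables (R : realType) (V : vectType R) (E : finType) (f : E -> V).

(* [config_reflect] is all that is used of the closure of a root system under
   its reflections. *)
Record root_configuration (ip : V -> V -> R) : Prop := RootConfiguration {
  configC : forall u v, ip u v = ip v u;
  configDl : forall u u' v, ip (u + u') v = ip u v + ip u' v;
  configZl : forall a u v, ip (a *: u) v = a * ip u v;
  config_eq0 : forall u, ip u u = 0 -> u = 0;
  config_neq0 : forall x, f x != 0;
  config_line : forall x y, x != y -> f x \notin <[f y]>%VS;
  config_reflect : forall x y, x != y -> ip (f x) (f y) != 0 ->
    exists z a b, [/\ a != 0, b != 0 & f z = a *: f x + b *: f y]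
}.

Variable ip : V -> V -> R.
Hypothesis cfg : root_configuration ip.
Implicit Types (A B C D F G H I J : {set E}) (x y z : E).
Local Notation M := (vector_matroid f).
Local Notation lspan := (lspan f).
Local Notation comb := (comb f).
Local Notation indep_mod := (indep_mod f).

Let ipC := configC cfg.

Lemma form0l v : ip 0 v = 0.
Proof. by rewrite -(scale0r 0) (configZl cfg) mul0r. Qed.

Lemma form_comb A c v : ip (comb A c) v = \sum_(x in A) c x * ip (f x) v.
Proof.
rewrite (big_morph (ip^~ v) (fun a b => configDl cfg a b v) (form0l v)).
by apply: eq_bigr => x _; rewrite (configZl cfg).
Qed.

Definition orth_sets A B := forall x y, x \in A -> y \in B -> ip (f x) (f y) = 0.

Lemma orth_setsS A B A' B' :
  A' \subset A -> B' \subset B -> orth_sets A B -> orth_sets A' B'.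
Proof. by move=> /subsetP sA /subsetP sB oAB x y /sA xA /sB; apply: oAB. Qed.

Lemma orth_lspan A B u v :
  orth_sets A B -> u \in lspan A -> v \in lspan B -> ip u v = 0.
Proof.
move=> oAB /lspanP[c ->] vB; rewrite form_comb big1 // => x xA.
move/lspanP: vB => [d ->]; rewrite ipC form_comb big1 ?mulr0 // => y yB.
by rewrite ipC oAB // mulr0.
Qed.

Lemma orth_lspan_eq0 A B u :
  orth_sets A B -> u \in lspan A -> u \in lspan B -> u = 0.
Proof. by move=> oAB uA uB; apply: (config_eq0 cfg); apply: orth_lspan oAB uA uB. Qed.

Lemma lspan_nonorth A x : f x \in lspan A -> exists2 y, y \in A & ip (f x) (f y) != 0.
Proof.
move=> xA; have [/exists_inP//|/exists_inPn orth] :=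
  boolP [exists y in A, ip (f x) (f y) != 0].
have /eqP : f x = 0; last by rewrite (negbTE (config_neq0 cfg x)).
apply: (orth_lspan_eq0 (A := A) (B := [set x])) => //.
  by move=> y z yA; rewrite inE => /eqP ->; have /negPn/eqP := orth y yA; rewrite ipC.
by apply: mem_lspan; rewrite inE.
Qed.

Lemma orth_self A x : x \in A -> (forall y, y \in A -> ip (f x) (f y) = 0) -> False.
Proof.
move=> xA orth; have [y yA] := lspan_nonorth (mem_lspan f xA).
by rewrite orth // eqxx.
Qed.

Definition adjacent F : rel E :=
  [rel x y | [&& x \in F, y \in F & ip (f x) (f y) != 0]].

Definition component F x := [set y in F | connect (adjacent F) x y].

(** Connectedness by cuts. It is mostly used to show that a nonempty subset, once orthogonal to its
    complement, is everything. *)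
Definition orth_connected G :=
  forall A, A \subset G -> A != set0 -> orth_sets A (G :\: A) -> A = G.

Lemma adjacent_sym F : connect_sym (adjacent F).
Proof. by apply: sym_connect_sym => x y; rewrite /adjacent /= ipC andbCA. Qed.

Lemma component_sub F x : component F x \subset F.
Proof. by apply/subsetP => y; rewrite inE => /andP[]. Qed.

Lemma mem_component F x : x \in F -> x \in component F x.
Proof. by rewrite inE connect0 => ->. Qed.

Lemma component_eq F x y : y \in component F x -> component F y = component F x.
Proof.
rewrite inE => /andP[_ xy]; apply/setP => z.
by rewrite !inE (same_connect (adjacent_sym F) xy).
Qed.

Lemma component_orth F x : orth_sets (component F x) (F :\: component F x).
Proof.
move=> y z yx; rewrite inE => /andP[zx zF]; apply/eqP; apply: contraR zx => yz.
move: yx; rewrite !inE => /andP[yF xy]; rewrite zF (connect_trans xy) //.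
by apply: connect1; rewrite /adjacent /= yF zF.
Qed.

Lemma component_closed F A x :
  x \in A -> A \subset F -> orth_sets A (F :\: A) -> component F x \subset A.
Proof.
move=> xA /subsetP AF oA; apply/subsetP => y; rewrite inE => /andP[_].
suff cl : closed (adjacent F) (mem A) by move/(closed_connect cl); rewrite xA => <-.
move=> u v /= /and3P[uF vF uv]; apply/idP/idP => [uA|vA]; apply: contraNT uv => nA.
  by rewrite oA // inE nA.
by rewrite ipC oA // inE nA.
Qed.

Lemma connected_sub_component F G x :
  orth_connected G -> G \subset F -> x \in G -> G \subset component F x.
Proof.
move=> cG GF xG; apply/setIidPl; apply: cG; first exact: subsetIl.
  by apply/set0Pn; exists x; rewrite inE xG mem_component // (subsetP GF).
apply: orth_setsS (component_orth (x := x)); first exact: subsetIr.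
by rewrite setDIr setDv set0U setSD.
Qed.

Lemma component_connected F x : orth_connected (component F x).
Proof.
move=> A sA /set0Pn[a aA] oA; apply/eqP; rewrite eqEsubset sA /=.
rewrite -(component_eq (subsetP sA a aA)); apply: component_closed => //.
  exact: subset_trans sA (component_sub _ _).
move=> y z yA; rewrite inE => /andP[zA zF].
have [zx|zx] := boolP (z \in component F x); first by apply: oA => //; rewrite inE zA.
by apply: (@component_orth F x); [exact: (subsetP sA) | rewrite inE zx].
Qed.

Lemma component_unique F G x : orth_connected G -> G \subset F ->
  orth_sets G (F :\: G) -> x \in G -> component F x = G.
Proof.
move=> cG GF oG xG; apply/eqP; rewrite eqEsubset component_closed //.
exact: connected_sub_component.
Qed.

Lemma componentS F F' x : x \in F -> F \subset F' ->
  component F x \subset component F' x.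
Proof.
move=> xF FF'; apply: connected_sub_component (mem_component xF).
  exact: component_connected.
exact: subset_trans (component_sub _ _) FF'.
Qed.

Lemma orth_connectedP G :
  orth_connected G <-> forall x, x \in G -> component G x = G.
Proof.
split=> [cG x xG | Gx].
  by apply: component_unique => // y z _; rewrite setDv inE.
move=> A AG /set0Pn[x xA] oA; apply/eqP; rewrite eqEsubset AG /=.
by rewrite -(Gx x) ?(subsetP AG) //; apply: component_closed.
Qed.

(** A root in the span of the component lies in [F]. If it were outside the component it would be
    orthogonal to it, contradicting [lspan_nonorth]. *)
Lemma component_flat F x : flat M F -> x \in F -> flat M (component F x).
Proof.
move=> flF xF; apply/flatP => y yx.
have yF : y \in F.
  by apply: (flatP _ _ flF); apply: (subvP (lspanS f (component_sub F x))).
apply/negPn/negP => nyx; have [z zx] := lspan_nonorth yx.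
by rewrite ipC (@component_orth F x) ?eqxx // inE nyx.
Qed.

Lemma in_restriction F D :
  (D \in indep (restriction M F)) = (D \in indep M) && (D \subset F).
Proof. exact: in_set. Qed.

Lemma circuit_restrictionP F C : reflect
  [/\ C \subset F, C \notin indep M & forall D, D \subset C -> D != C -> D \in indep M]
  (circuit (restriction M F) C).
Proof.
have PE D : (D \subset ground (restriction M F)) && (D \notin indep (restriction M F))
    = (D \subset F) && (D \notin indep M).
  rewrite in_restriction [ground _]/= setTI; case: (D \subset F) => //=.
  by rewrite andbT.
rewrite /circuit; apply: (iffP minsetP); rewrite PE.
  move=> [/andP[CF nC] minC]; split=> // D DC; apply: contraR => nD.
  by apply/eqP; apply: minC => //; rewrite PE nD (subset_trans DC CF).
move=> [-> nC minC]; split=> // D; rewrite PE => /andP[_ nD] DC.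
by apply/eqP; apply: contraR nD; apply: minC.
Qed.

(** If both parts were nonempty they would be proper subsets of a circuit, hence independent;
    orthogonal spans meet in 0, so the whole circuit would be independent. *)
Lemma circuit_orth F A C : circuit (restriction M F) C ->
  orth_sets (C :&: A) (C :\: A) -> C :&: A = set0 \/ C :\: A = set0.
Proof.
move=> /circuit_restrictionP[CF nC ind] oC.
have [->|A0] := eqVneq (C :&: A) set0; first by left.
have [->|A1] := eqVneq (C :\: A) set0; first by right.
case/negP: nC; apply/indep_vectorP.
rewrite -(setID C A); apply/indep_modU.
  by apply/pred0P => x /=; rewrite !inE; case: (x \in A); rewrite ?andbF.
split; last first.
  apply/indep_vectorP; apply: ind; first exact: subsetDl.
  apply: contraNneq A0 => <-; apply/eqP/setP => x.
  by rewrite !inE; case: (x \in A); rewrite ?andbF.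
have /indep_vectorP iA : C :&: A \in indep M.
  apply: ind; first exact: subsetIl.
  apply: contraNneq A1 => <-; apply/eqP/setP => x.
  by rewrite !inE; case: (x \in A); rewrite ?andbF.
move=> c; rewrite add0v => cB; apply: iA.
by rewrite (orth_lspan_eq0 oC (comb_lspan f _ c) cB) mem0v.
Qed.

(** The circuit is [x], [y] and the root [z] of [config_reflect]. Flatness puts [z] in [F], and any
    two of the three are independent because distinct roots are never parallel. *)
Lemma circuit_adjacent F x y : flat M F -> x \in F -> y \in F ->
  ip (f x) (f y) != 0 -> connect (in_common_circuit (restriction M F)) x y.
Proof.
move=> flF xF yF; have [-> _|nxy nz] := eqVneq x y; first exact: connect0.
have [z [a [b [a0 b0 zE]]]] := config_reflect cfg nxy nz.
have pair u v : u != v -> indep_mod 0 [set u; v].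
  move=> uv; apply/indep_modU1; first by rewrite inE.
  split; first by apply/indep_mod1; rewrite memv0 (config_neq0 cfg).
  by rewrite add0v /lspan big_set1 (config_line cfg).
have zx : z != x.
  apply/eqP => zx; have /negP := config_line cfg nxy; rewrite eq_sym in nxy.
  case/negP: (config_line cfg nxy); apply/vlineP; exists (b^-1 * (1 - a)).
  rewrite -scalerA scalerBl scale1r; move: zE; rewrite zx => {1}->.
  by rewrite addrAC subrr add0r scalerA mulVf // scale1r.
have zy : z != y.
  apply/eqP => zy; case/negP: (config_line cfg nxy); apply/vlineP.
  exists (a^-1 * (1 - b)); rewrite -scalerA scalerBl scale1r.
  by move: zE; rewrite zy => {1}->; rewrite addrK scalerA mulVf // scale1r.
have zF : z \in F by apply: (flatP _ _ flF); rewrite zE memvD ?memvZ ?mem_lspan.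
apply: connect1; apply/existsP; exists [set x; y; z].
rewrite !inE !eqxx orbT /= andbT; apply/circuit_restrictionP; split.
- by rewrite !subUset !sub1set xF yF.
- apply/negP => /indep_vectorP; rewrite setUC => /indep_modU1[].
    by rewrite !inE negb_or zx.
  move=> _ /negP[]; rewrite add0v zE.
  by rewrite memvD ?memvZ ?mem_lspan ?inE ?eqxx ?orbT.
move=> D DC; rewrite eqEsubset DC /= => /subsetPn[u uC uD].
apply/indep_vectorP.
have Dv v : v \in D -> [|| v == x, v == y | v == z] && (v != u).
  move=> vD; have := subsetP DC v vD; rewrite !inE -orbA => -> /=.
  by apply: contraNneq uD => <-.
move: uC; rewrite !inE -orbA => /or3P[] /eqP uE.
- apply: indep_modS (pair y z _); last by rewrite eq_sym.
  apply/subsetP => v /Dv; rewrite uE !inE => /andP[]; by case: eqVneq.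
- apply: indep_modS (pair x z _); last by rewrite eq_sym.
  apply/subsetP => v /Dv; rewrite uE !inE => /andP[].
  by case: (eqVneq v y) => //; rewrite orbF.
- apply: indep_modS (pair x y nxy).
  apply/subsetP => v /Dv; rewrite uE !inE => /andP[].
  by case: (eqVneq v z) => //; rewrite !orbF.
Qed.

Lemma connect_circuit F x y : flat M F -> x \in F ->
  connect (in_common_circuit (restriction M F)) x y = connect (adjacent F) x y.
Proof.
move=> flF xF; apply/idP/idP; last first.
  by apply: connect_sub => u v /= /and3P[]; apply: circuit_adjacent.
have cl : closed (in_common_circuit (restriction M F)) (mem (component F x)).
  move=> u v /existsP[C /and3P[cC uC vC]] /=.
  have CF : C \subset F.
    by have /circuit_restrictionP[] := cC.
  have [|C0|C0] := circuit_orth (A := component F x) cC.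
  - apply: orth_setsS (component_orth (x := x)); first exact: subsetIr.
    exact: setSD.
  - have out z : z \in C -> (z \in component F x) = false.
      by move=> zC; move/setP/(_ z): C0; rewrite in_setI zC in_set0.
    by rewrite !out.
  - have inc z : z \in C -> z \in component F x.
      by move=> zC; move/eqP: C0; rewrite setD_eq0 => /subsetP ->.
    by rewrite !inc.
by move/(closed_connect cl); rewrite mem_component // inE => /esym/andP[].
Qed.

Lemma flat_componentsE F : flat M F ->
  flat_components M F = [set component F x | x in F].
Proof.
move=> flF; rewrite /flat_components /components /= setTI; apply: eq_in_imset => x xF.
by apply/setP => y; rewrite !inE connect_circuit.
Qed.

Lemma mconnectedP F : flat M F -> mconnected (restriction M F) <-> orth_connected F.
Proof.
move=> flF; rewrite orth_connectedP /mconnected /= setTI; split=> cF x.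
  move=> xF; apply/setP => y; rewrite inE andb_idr // => yF.
  by rewrite -connect_circuit // cF.
move=> y xF yF; rewrite connect_circuit //.
by move: yF; rewrite -{1}(cF x xF) inE => /andP[].
Qed.

Lemma flatT : flat M [set: E].
Proof. by apply/flatP => x; rewrite inE. Qed.

Lemma componentsE : components M = [set component [set: E] x | x in [set: E]].
Proof.
rewrite -(flat_componentsE flatT) /flat_components; congr components.
rewrite /restriction setTI; congr Matroid.
by apply/setP => I; rewrite !inE subsetT andbT.
Qed.

End RootConfiguration.

(** * Flag matroid of a weight against the components of its sublevel sets *)

Section WeightComponents.
Variables (R : realType) (V : vectType R) (E : finType) (f : E -> V).
Variable ip : V -> V -> R.
Hypothesis cfg : root_configuration f ip.
Implicit Types (A B C D F G H I J : {set E}) (x y z : E).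
Local Notation M := (vector_matroid f).
Local Notation lspan := (lspan f).
Local Notation comb := (comb f).
Local Notation indep_mod := (indep_mod f).
Local Notation component := (component f ip).
Local Notation orth_sets := (orth_sets f ip).
Local Notation orth_connected := (orth_connected f ip).

(** For a matroid this says that [x] and [y] are distinct elements of a common circuit, [I] being
    the rest of the circuit or more. It is phrased by independent sets, the form in which flag
    matroids are known here. *)
Definition exchange_rel (N : matroid E) : rel E :=
  [rel x y | [exists I : {set E},
    [&& x |: I \in indep N, y |: I \in indep N & x |: (y |: I) \notin indep N]]].

Definition below (N : {set {set E}}) G : {set E} := \bigcup_(H in N | H \proper G) H.

Lemma addv_line_exchange (U : {vspace V}) p q :
  p \in (U + <[q]>)%VS -> p \notin U -> q \in (U + <[p]>)%VS.
Proof.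
move=> /memv_addP[u uU [_ /vlineP[c ->] ->]] npU.
have c0 : c != 0 by apply: contraNneq npU => ->; rewrite scale0r addr0.
suff : c *: q \in (U + <[u + c *: q]>)%VS by rewrite rpredZeq (negbTE c0).
by rewrite -{1}(addKr u (c *: q)) memv_add ?memvN ?memv_line.
Qed.

Lemma mem_of_combination (U : {vspace V}) u p q a b :
  u = a *: p + b *: q -> a != 0 -> u \in U -> q \in U -> p \in U.
Proof.
move=> uE a0 uU qU; suff : a *: p \in U by rewrite rpredZeq (negbTE a0).
by rewrite -(addrK (b *: q) (a *: p)) -uE memvB ?memvZ.
Qed.

Section OneWeight.
Variable w : {ffun E -> R}.
Local Notation Mw := (flag_matroid M (level_flag w)).
Local Notation le t := (sublevel w t).
Local Notation lt t := (strict_sublevel w t).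
Local Notation lv t := (level w t).

Definition wcomp x := component (le (w x)) x.
Definition wtop x := wcomp x :&: lv (w x).
Definition wbot x := wcomp x :&: lt (w x).

Lemma mem_wcomp x : x \in wcomp x.
Proof. by apply: mem_component; rewrite inE. Qed.

Lemma wcomp_le x y : y \in wcomp x -> w y <= w x.
Proof. by rewrite !inE => /andP[]. Qed.

Lemma wcomp_connected x : orth_connected (wcomp x).
Proof. exact: component_connected. Qed.

Lemma wcomp_eq x y : y \in wcomp x -> w x <= w y -> wcomp y = wcomp x.
Proof.
move=> yx wxy; have wE : w y = w x by apply/le_anti; rewrite wxy wcomp_le.
by rewrite /wcomp wE; apply: component_eq.
Qed.

Lemma wcompS x y : x \in wcomp y -> wcomp x \subset wcomp y.
Proof.
move=> xy; rewrite -[wcomp y](component_eq cfg xy); apply: componentS => //.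
  by rewrite inE.
by apply/subsetP => z; rewrite !inE => /le_trans; apply; apply: wcomp_le.
Qed.

(** Take [x] in the component with [w x] maximal: the component lies in the sublevel set of [x],
    which lies in [F], so it is a component of both. *)
Lemma component_wcomp F y : (forall x, x \in F -> le (w x) \subset F) -> y \in F ->
  exists2 x, x \in component F y & wcomp x = component F y.
Proof.
move=> leF yF; have yC := mem_component f ip yF.
case: (arg_maxP (P := mem (component F y)) w yC) => x xC xmax.
have xF := subsetP (component_sub f ip F y) x xC.
exists x => //; apply: component_unique => //.
- exact: component_connected.
- by apply/subsetP => z zC; rewrite inE; apply: xmax.
- apply: orth_setsS (@component_orth _ _ _ f ip F y) => //.
  by apply: setSD; apply: leF.
Qed.

Lemma in_wtop x y : (y \in wtop x) = (y \in wcomp x) && (w y == w x).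
Proof. by rewrite in_setI [y \in lv _]inE. Qed.

Lemma in_wbot x y : (y \in wbot x) = (y \in wcomp x) && (w y < w x).
Proof. by rewrite in_setI [y \in lt _]inE. Qed.

Lemma wtop_eq x y : y \in wtop x -> wtop y = wtop x.
Proof.
rewrite in_wtop => /andP[yx /eqP wyx].
by rewrite /wtop (wcomp_eq yx) wyx.
Qed.

Lemma mem_wtop x : x \in wtop x.
Proof. by rewrite in_wtop mem_wcomp eqxx. Qed.

Lemma wtop_wbot x : wcomp x :\: wbot x = wtop x.
Proof.
apply/setP => y; rewrite in_setD in_wbot in_wtop.
case: (boolP (y \in wcomp x)) => [yx|]; last by rewrite andbF.
by rewrite /= andbT -leNgt [RHS]eq_le (wcomp_le yx).
Qed.

(** This recovers [wbot x] from the family of components without reference to [w], so that two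
    weights with the same family have the same contractions. *)
Lemma below_wcomp x : below [set wcomp y | y in [set: E]] (wcomp x) = wbot x.
Proof.
apply/setP => y; rewrite inE; apply/bigcupP/idP => [[H]|/andP[yx]].
  move=> /andP[/imsetP[z _ ->] /properP[/subsetP zx [u ux uz]] yz].
  rewrite zx //= inE lt_neqAle wcomp_le ?zx // andbT.
  apply: contraNneq uz => wyx.
  have zE : wcomp z = wcomp x.
    by apply: wcomp_eq; [exact/zx/mem_wcomp | rewrite -wyx wcomp_le].
  by rewrite zE.
rewrite inE => wyx; exists (wcomp y); last exact: mem_wcomp.
rewrite imset_f ?inE //; apply/properP; split; first exact: wcompS.
by exists x; [exact: mem_wcomp | apply: contraTN wyx => /wcomp_le; rewrite leNgt].
Qed.

Hypothesis flw : forall x, flat M (le (w x)).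

Lemma wcomp_flat x : flat M (wcomp x).
Proof. by apply: component_flat => //; rewrite inE. Qed.

(** A nonempty strict sublevel set is the full one at its largest value; the empty set is flat
    because no root vanishes. *)
Lemma strict_sublevel_flat t : flat M (lt t).
Proof.
have [lt0|[x xt]] := set_0Vmem (lt t).
  apply/flatP => x; rewrite lt0 memvE [lspan set0]big_set0 -memvE memv0.
  by rewrite (negbTE (config_neq0 cfg x)).
case: (arg_maxP (P := mem (lt t)) w xt) => y yt ymax.
suff -> : lt t = le (w y) by [].
apply/setP => z; rewrite [RHS]inE; apply/idP/idP; first exact: ymax.
have {}yt : w y < t by have : y \in lt t := yt; rewrite inE.
by rewrite [z \in lt t]inE => /le_lt_trans; apply.
Qed.

Lemma strict_notin x y : w y = w x -> f y \notin lspan (lt (w x)).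
Proof.
move=> wyx; apply/negP => /(flatP _ _ (strict_sublevel_flat _)).
by rewrite inE wyx ltxx.
Qed.

(** The third root lies in the flat [wcomp x]. If its weight were lower, [f k] would be in the span
    of the strict sublevel set, itself a flat. *)
Lemma reflect_wtop x k d : k \in wtop x -> d \in wbot x -> ip (f k) (f d) != 0 ->
  exists u a b, [/\ u \in wtop x, a != 0, b != 0 & f u = a *: f k + b *: f d].
Proof.
rewrite in_wtop in_wbot => /andP[kx /eqP wk] /andP[dx wd] nz.
have kd : k != d by apply: contraTneq wd => <-; rewrite wk ltxx.
have [u [a [b [a0 b0 uE]]]] := config_reflect cfg kd nz.
exists u, a, b; split=> //.
have ux : u \in wcomp x.
  by apply: (flatP _ _ (wcomp_flat x)); rewrite uE memvD ?memvZ ?mem_lspan.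
rewrite in_wtop ux eq_le wcomp_le //= leNgt; apply/negP => wu.
have /negP := strict_notin wk; apply.
by apply: (mem_of_combination uE a0); apply: mem_lspan; rewrite inE.
Qed.

(** A lower root not orthogonal to a top root [k] is a combination of [k] and the top root [u] given
    by [reflect_wtop], hence lies in the closure. So the closure is orthogonal to the rest of the
    connected set [wcomp x]. *)
Lemma wtop_closure x : mclosure M (wtop x) = wcomp x.
Proof.
apply/eqP; rewrite eqEsubset mclosure_flat ?wcomp_flat ?subsetIl //=.
suff <- : wcomp x :&: mclosure M (wtop x) = wcomp x by apply: subsetIr.
apply: (wcomp_connected (x := x)); first exact: subsetIl.
  apply/set0Pn; exists x; rewrite inE mem_wcomp /=.
  exact: (subsetP (subset_mclosure _ _)) (mem_wtop x).
move=> y z; rewrite in_setI in_setD in_setI !mem_mclosure => /andP[yx yK] /andP[].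
case: (boolP (z \in wcomp x)) => //= zx zK _.
apply: (orth_lspan cfg (A := wtop x) (B := [set z])) => //; last first.
  by apply: mem_lspan; rewrite inE.
move=> k _ kK /set1P ->; apply/eqP; apply/negPn/negP => nz; case/negP: (zK).
have zD : z \in wbot x.
  rewrite in_wbot zx lt_neqAle wcomp_le // andbT; apply: contraNneq zK => wz.
  by apply: mem_lspan; rewrite in_wtop zx wz eqxx.
have [u [a [b [uK a0 b0 uE]]]] := reflect_wtop kK zD nz.
by rewrite addrC in uE; apply: (mem_of_combination uE b0); apply: mem_lspan.
Qed.

Definition flag_indep I :=
  forall x, indep_mod (lspan (lt (w x))) (I :&: lv (w x)).

Lemma flag_indepP I : reflect (flag_indep I) (I \in indep Mw).
Proof. by apply: (iffP idP) => /indep_flag_matroidP. Qed.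

(** The components of a sublevel set are mutually orthogonal, so a linear relation on a level modulo
    lower roots splits into one relation per component. *)
Lemma flag_indep_components I :
  flag_indep I <-> forall x, indep_mod (lspan (wbot x)) (I :&: wtop x).
Proof.
split=> [iI x | iI x c cU y].
  apply: indep_modS (setIS I (subsetIr _ _)) _.
  by apply: indep_modW (lspanS f (subsetIr _ _)) (iI x).
rewrite in_setI => /andP[yI]; rewrite [y \in lv _]inE => /eqP wy.
pose G := wcomp y; pose F := le (w x).
have GF : G \subset F by rewrite /F -wy; apply: component_sub.
have sub1 : (I :&: lv (w x)) :&: G = I :&: wtop y.
  by rewrite /wtop wy -/G -setIA [lv _ :&: G]setIC.
have vU : comb (I :&: lv (w x)) c \in lspan (lt (w x)) by [].
move: vU; rewrite (combI _ _ G) sub1 -(setID (lt (w x)) G) lspanU.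
move=> /memv_addP[u1 u1U [u2 u2U vE]].
have sub2 : lt (w x) :&: G = wbot y by rewrite /wbot wy setIC.
rewrite sub2 in u1U.
(* The part of the relation inside [G] is also a combination of roots outside [G]; the two spans are
   orthogonal. *)
have d0 : comb (I :&: wtop y) c - u1 = 0.
  apply: (orth_lspan_eq0 cfg (A := G) (B := F :\: G)).
  - by rewrite /F -wy; apply: component_orth.
  - rewrite memvB //.
      apply: (subvP (lspanS f _)) (comb_lspan _ _ _).
      by apply: subset_trans (subsetIr _ _) (subsetIl _ _).
    by apply: (subvP (lspanS f (subsetIl _ _))) u1U.
  - have -> : comb (I :&: wtop y) c - u1 = u2 - comb ((I :&: lv (w x)) :\: G) c.
      by apply/eqP; rewrite subr_eq addrAC eq_sym subr_eq addrC -vE.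
    rewrite memvB //.
      by apply: (subvP (lspanS f (setSD _ (strict_sublevelS _ _)))) u2U.
    apply: (subvP (lspanS f _)) (comb_lspan _ _ _); apply: setSD.
    by apply/subsetP => z; rewrite !inE => /andP[_ /eqP ->].
apply: (iI y c); last by rewrite in_setI yI mem_wtop.
by move/eqP: d0; rewrite subr_eq0 => /eqP ->.
Qed.

Lemma flag_indep_level x I : I \subset lv (w x) ->
  indep_mod (lspan (lt (w x))) I -> flag_indep I.
Proof.
move=> /subsetP Ix iI y; have [wxy|wxy] := eqVneq (w x) (w y).
  by apply: indep_modS (subsetIl _ _) _; rewrite -wxy.
move=> c _ z; rewrite !inE => /andP[/Ix]; rewrite inE => /eqP -> /eqP xy.
by rewrite xy eqxx in wxy.
Qed.

Lemma flag_indep_level_mod x I : I \subset lv (w x) -> flag_indep I ->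
  indep_mod (lspan (lt (w x))) I.
Proof. by move=> Ix /(_ x); rewrite (setIidPl Ix). Qed.

(** Independence is tested on each [wtop] separately, and if [y] is not in [wtop x] no test involves
    both [x] and [y]. *)
Lemma exchange_wtop x y : exchange_rel Mw x y -> y \in wtop x.
Proof.
move=> /existsP[I /and3P[/flag_indepP/flag_indep_components ix]].
move=> /flag_indepP/flag_indep_components iy /flag_indepP nxy.
apply/negPn/negP => yx; apply: nxy; apply/flag_indep_components => z.
have [yz|yz] := boolP (y \in wtop z); last first.
  suff -> : (x |: (y |: I)) :&: wtop z = (x |: I) :&: wtop z by apply: ix.
  apply/setP => u; rewrite [LHS]in_setI [RHS]in_setI !in_setU1.
  by case: (eqVneq u y) => [->|]; rewrite ?(negbTE yz) ?andbF.
suff -> : (x |: (y |: I)) :&: wtop z = (y |: I) :&: wtop z by apply: iy.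
apply/setP => u; rewrite [LHS]in_setI [RHS]in_setI !in_setU1.
case: (eqVneq u x) => [->|] //=; suff /negbTE -> : x \notin wtop z by rewrite andbF.
by apply: contra yx => xz; rewrite (wtop_eq xz).
Qed.

Lemma exchange_parallel x y : w x = w y -> f y \in (lspan (lt (w x)) + <[f x]>)%VS ->
  x != y -> exchange_rel Mw x y.
Proof.
move=> wxy yx nxy; apply/existsP; exists set0.
rewrite !setU0 setUC; apply/and3P; split.
- apply/flag_indepP/(@flag_indep_level x); first by rewrite sub1set inE.
  by apply/indep_mod1; apply: strict_notin.
- apply/flag_indepP/(@flag_indep_level x); first by rewrite sub1set inE wxy.
  by apply/indep_mod1; apply: strict_notin.
- apply/flag_indepP => /(@flag_indep_level_mod x).
  rewrite subUset !sub1set !inE wxy eqxx => /(_ isT)/indep_modU1.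
  rewrite inE eq_sym nxy => /(_ isT)[_ /negP[]].
  by rewrite -wxy [lspan [set x]]big_set1.
Qed.

(** If [x] and [y] are parallel modulo the lower roots, the empty set is a witness. Otherwise the
    third root [z] has the same weight and is parallel to neither of them modulo lower roots, and
    [[set z]] is a witness. *)
Lemma exchange_nonorth x y : w x = w y -> ip (f x) (f y) != 0 -> x != y ->
  exchange_rel Mw x y.
Proof.
move=> wxy nz nxy; set U := lspan (lt (w x)).
have [yU|nyU] := boolP (f y \in (U + <[f x]>)%VS); first exact: exchange_parallel.
have nxU : f x \notin (U + <[f y]>)%VS.
  apply: contra nyU => xU; apply: addv_line_exchange xU _; exact: strict_notin.
have [z [a [b [a0 b0 zE]]]] := config_reflect cfg nxy nz.
have zF : z \in le (w x).
  apply: (flatP _ _ (flw x)).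
  by rewrite zE memvD // memvZ // mem_lspan // inE ?wxy.
have qU q : f q \in (U + <[f q]>)%VS.
  by apply: (subvP (addvSr _ _)); apply: memv_line.
have zU : f z \notin U.
  apply: contra nxU => zU; apply: mem_of_combination zE a0 _ (qU y).
  exact: (subvP (addvSl _ _)).
have wz : w z = w x.
  apply/eqP; rewrite eq_le; move: (zF); rewrite inE => -> /=.
  by rewrite leNgt; apply: contra zU => wz; apply: mem_lspan; rewrite inE.
have nx : f x \notin (U + <[f z]>)%VS.
  apply: contra nyU => xU.
  have zx : f z \in (U + <[f x]>)%VS.
    by apply: addv_line_exchange xU _; apply: strict_notin.
  by rewrite addrC in zE; apply: mem_of_combination zE b0 _ _.
have ny : f y \notin (U + <[f z]>)%VS.
  apply: contra nxU => yU.
  have zy : f z \in (U + <[f y]>)%VS.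
    by apply: addv_line_exchange yU _; apply: strict_notin.
  exact: mem_of_combination zE a0 _ _.
have neq p : f p \notin (U + <[f z]>)%VS -> p != z.
  by apply: contraNneq => ->; apply: qU.
have pair p : w p = w x -> f p \notin (U + <[f z]>)%VS -> p |: [set z] \in indep Mw.
  move=> wp np; apply/flag_indepP/(@flag_indep_level x).
    by rewrite subUset !sub1set !inE wp wz eqxx.
  apply/indep_modU1; first by rewrite inE neq.
  by split; [apply/indep_mod1 | rewrite [lspan [set z]]big_set1].
apply/existsP; exists [set z]; rewrite !pair //=.
apply/flag_indepP => /(@flag_indep_level_mod x).
rewrite !subUset !sub1set !inE wz wxy eqxx => /(_ isT).
rewrite setUA setUC => /indep_modU1; rewrite !inE negb_or ![z == _]eq_sym !neq //.
move=> /(_ isT)[_ /negP[]]; apply: (subvP (addvSr _ _)).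
by rewrite zE memvD ?memvZ ?mem_lspan ?inE ?eqxx ?orbT.
Qed.

(** Connectedness of the summand on [wtop x]. Let [A] be the class of [x] and [D1] the lower roots
    not orthogonal to [A]; it is shown that [A :|: D1] is orthogonal to the rest of [wcomp x], hence
    equal to it. *)
Lemma wtop_connect x : wtop x = [set y | connect (exchange_rel Mw) x y].
Proof.
have cl : closed (exchange_rel Mw) (mem (wtop x)).
  move=> u v /exchange_wtop vu; have vE := wtop_eq vu.
  apply/idP/idP => [ux|vx]; first by rewrite -(wtop_eq ux).
  by rewrite -(wtop_eq vx) vE mem_wtop.
apply/eqP; rewrite eqEsubset andbC; apply/andP; split.
  apply/subsetP => y; rewrite inE => /(closed_connect cl).
  by rewrite [x \in _]mem_wtop => <-.
pose A := [set y in wtop x | connect (exchange_rel Mw) x y].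
pose D1 := [set d in wbot x | [exists a in A, ip (f a) (f d) != 0]].
suff AK : wtop x \subset A.
  by apply: subset_trans AK _; apply/subsetP => y; rewrite !inE => /andP[].
have AP y : y \in A -> y \in wtop x /\ connect (exchange_rel Mw) x y.
  by rewrite inE => /andP[].
have wK y : y \in wtop x -> w y = w x by rewrite in_wtop => /andP[_ /eqP].
have Aclosed a y : a \in A -> y \in wtop x -> exchange_rel Mw a y -> y \in A.
  move=> /AP[_ xa] yK ay; rewrite inE yK; apply: connect_trans xa (connect1 ay).
have orthA a y : a \in A -> y \in wtop x -> y \notin A -> ip (f a) (f y) = 0.
  move=> aA yK nyA; have [aK _] := AP a aA.
  apply/eqP/negPn/negP => nz; case/negP: (nyA); apply: (Aclosed a y aA yK).
  apply: exchange_nonorth => //; first by rewrite !wK.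
  by apply: contraNneq nyA => <-.
(* The third root [u] is parallel to [a] modulo lower roots, hence exchangeable with it and again in
   [A]. So [f d] is a combination of two members of [A] and inherits their orthogonality
   relations. *)
have reflD a d : a \in A -> d \in wbot x -> ip (f a) (f d) != 0 ->
    exists u p q, [/\ u \in A, p != 0, q != 0 & f u = p *: f a + q *: f d].
  move=> aA dD nz; have [aK _] := AP a aA.
  have [u [p [q [uK p0 q0 uE]]]] := reflect_wtop aK dD nz.
  exists u, p, q; split=> //; have [ua|ua] := eqVneq a u; first by rewrite -ua.
  apply: (Aclosed a u aA uK); apply: exchange_parallel => //; first by rewrite !wK.
  rewrite uE addrC memv_add ?memvZ ?memv_line // wK //.
  by apply: mem_lspan; move: dD; rewrite in_wbot [d \in lt _]inE => /andP[].
have D1orth d y : d \in D1 -> y \in wtop x -> y \notin A -> ip (f d) (f y) = 0.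
  rewrite inE => /andP[dD /exists_inP[a aA nz]] yK nyA.
  have [u [p [q [uA p0 q0 uE]]]] := reflD a d aA dD nz.
  have := orthA u y uA yK nyA; rewrite uE (configDl cfg) !(configZl cfg).
  by rewrite (orthA a) // mulr0 add0r => /eqP; rewrite mulf_eq0 (negbTE q0) => /eqP.
have D1span d : d \in D1 -> f d \in lspan A.
  rewrite inE => /andP[dD /exists_inP[a aA nz]].
  have [u [p [q [uA p0 q0 uE]]]] := reflD a d aA dD nz.
  by rewrite addrC in uE; apply: (mem_of_combination uE q0); apply: mem_lspan.
have GE y : y \in wcomp x -> (y \in wtop x) || (y \in wbot x).
  move=> yx; rewrite in_wtop in_wbot yx /=.
  by rewrite -le_eqVlt wcomp_le.
have : A :|: D1 = wcomp x.
  apply: (wcomp_connected (x := x)).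
  - apply/subsetP => y; rewrite in_setU => /orP[/AP[]|].
      by rewrite in_wtop => /andP[].
    by rewrite inE in_wbot -andbA => /andP[].
  - by apply/set0Pn; exists x; rewrite in_setU inE mem_wtop connect0.
  move=> y z; rewrite in_setU => yX; rewrite in_setD in_setU negb_or.
  move=> /andP[/andP[zA zD] zx].
  case/orP: (GE z zx) => [zK|zB].
    by case/orP: yX => [yA|yD]; [exact: orthA | exact: D1orth].
  apply: (orth_lspan cfg (A := A) (B := [set z])); last 1 first.
  - by apply: mem_lspan; rewrite inE.
  - move=> a _ aA /set1P ->; apply/eqP; apply: contraNT zD => nz.
    by rewrite inE zB; apply/exists_inP; exists a.
  - by case/orP: yX => [yA|yD]; [exact: mem_lspan | exact: D1span].
move=> XE; apply/subsetP => y yK.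
have : y \in A :|: D1 by rewrite XE; move: yK; rewrite in_wtop => /andP[].
rewrite in_setU => /orP[//|]; rewrite inE in_wbot => /andP[/andP[_]].
by rewrite wK // ltxx.
Qed.

End OneWeight.

Lemma flag_matroid_wcomp (w v : {ffun E -> R}) :
  (forall x, flat M (sublevel w (w x))) -> (forall x, flat M (sublevel v (v x))) ->
  flag_matroid M (level_flag w) = flag_matroid M (level_flag v) <->
  [set wcomp w x | x in [set: E]] = [set wcomp v x | x in [set: E]].
Proof.
move=> flw flv; split=> [eM | eN].
  apply: eq_in_imset => x _.
  by rewrite -!wtop_closure // !wtop_connect // eM.
have half (u u' : {ffun E -> R}) I :
    [set wcomp u x | x in [set: E]] = [set wcomp u' x | x in [set: E]] ->
    flag_indep u I -> flag_indep u' I.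
  move=> eN' /flag_indep_components iI; apply/flag_indep_components => x.
  have : wcomp u' x \in [set wcomp u x | x in [set: E]] by rewrite eN' imset_f ?inE.
  move=> /imsetP[y _ xy].
  have := iI y; rewrite -wtop_wbot -(wtop_wbot u') -below_wcomp -(below_wcomp u').
  by rewrite eN' xy.
have groundE : ground (flag_matroid M (level_flag w)) =
    ground (flag_matroid M (level_flag v)).
  by rewrite !ground_flag_matroid.
have indepE : indep (flag_matroid M (level_flag w)) =
    indep (flag_matroid M (level_flag v)).
  apply/setP => I; apply/flag_indepP/flag_indepP; exact: half.
by case: (flag_matroid M (level_flag w)) (flag_matroid M (level_flag v)) groundE indepE
  => [g i] [g' i'] /= -> ->.
Qed.

End WeightComponents.

(** * Flags give nested sets; orthogonality and unions of members of a nested set *)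

Section NestedSets.
Variables (R : realType) (V : vectType R) (E : finType) (f : E -> V).
Variable ip : V -> V -> R.
Hypothesis cfg : root_configuration f ip.
Implicit Types (A B C D F G H I J X Y : {set E}) (x y z : E) (N : {set {set E}}).
Implicit Types w : {ffun E -> R}.
Local Notation M := (vector_matroid f).
Local Notation lspan := (lspan f).
Local Notation component := (component f ip).
Local Notation orth_sets := (orth_sets f ip).
Local Notation orth_connected := (orth_connected f ip).
Local Notation wcomp := (wcomp f ip).

Let ipC := configC cfg.

Lemma flag_of_flatsP w :
  flag_of_flats M (level_flag w) <-> forall x, flat M (sublevel w (w x)).
Proof.
have [_ F0 Flast Fsort _] := level_flag_spec w.
split=> [[_ _ _ /allP fl] x|fl].
  apply: fl; rewrite inE; apply/orP; right.
  by apply: (map_f (sublevel w)); apply/mem_level_values; exists x.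
split=> //; rewrite /= ; apply/andP; split.
  (* Any lower bound of [w] would do: the default 0 can only lower the minimum. *)
  have -> : finset.set0 = strict_sublevel w (\big[Order.min/0]_x w x).
    apply/setP => x; rewrite !inE; apply/esym/negbTE; rewrite -leNgt.
    exact: bigmin_le.
  exact: (strict_sublevel_flat cfg fl).
by apply/allP => _ /mapP[t /mem_level_values[x ->] ->]; apply: fl.
Qed.

Lemma in_bigcup_seq (T : eqType) (r : seq T) (P : T -> {set {set E}}) G :
  (G \in \bigcup_(i <- r) P i) = has (fun i => G \in P i) r.
Proof. by elim: r => [|i r IHr]; rewrite ?big_nil ?big_cons inE // IHr. Qed.

Lemma flag_componentsE w : (forall x, flat M (sublevel w (w x))) ->
  flag_components M (level_flag w) = [set wcomp w x | x in [set: E]].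
Proof.
move=> flw; rewrite /flag_components /= big_map.
apply/setP => G; rewrite in_bigcup_seq; apply/hasP/imsetP.
  move=> [t /mem_level_values[x ->]]; rewrite (flat_componentsE cfg (flw x)).
  move=> /imsetP[y yx ->].
  have leF u : u \in sublevel w (w x) -> sublevel w (w u) \subset sublevel w (w x).
    by rewrite inE => ux; apply/subsetP => v; rewrite !inE => /le_trans; apply.
  by have [z _ <-] := component_wcomp cfg leF yx; exists z.
move=> [x _ ->]; exists (w x); first by apply/mem_level_values; exists x.
rewrite (flat_componentsE cfg (flw x)); apply: imset_f; by rewrite inE.
Qed.

Lemma components_wcomp w : components M \subset [set wcomp w x | x in [set: E]].
Proof.
rewrite (componentsE cfg); apply/subsetP => _ /imsetP[y _ ->].
have [|z _ <-] := component_wcomp cfg (w := w) (F := setT) (y := y) _ (in_setT y).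
  by move=> x _; apply: subsetT.
by rewrite imset_f ?inE.
Qed.

Lemma component_full_connected F x : component F x = F -> orth_connected F.
Proof. by move=> <-; apply: component_connected. Qed.

Lemma component_adjacent F x y : x \in F -> y \in F -> ip (f x) (f y) != 0 ->
  y \in component F x.
Proof.
move=> xF yF; apply: contraR => ny.
by rewrite (@component_orth _ _ _ f ip F x) ?mem_component // inE ny.
Qed.

Lemma orth_connectedU G H x y : orth_connected G -> orth_connected H ->
  x \in G -> y \in H -> ip (f x) (f y) != 0 -> orth_connected (G :|: H).
Proof.
move=> cG cH xG yH xy; apply: (@component_full_connected _ x).
apply/eqP; rewrite eqEsubset component_sub subUset.
rewrite (connected_sub_component cG) ?subsetUl //=.
have yx : y \in component (G :|: H) x.
  by apply: component_adjacent; rewrite ?inE ?xG ?yH ?orbT.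
by rewrite -(component_eq cfg yx) (connected_sub_component cH) ?subsetUr.
Qed.

(** Each root of [Y] is in the span of [X], so it is adjacent to some element of [X], and [X] lies
    in a single component. *)
Lemma orth_connected_closure X Y : X \subset Y -> (Y \subset mclosure M X) ->
  (exists2 x, x \in Y & X \subset component Y x) -> orth_connected Y.
Proof.
move=> XY /subsetP YX [x xY Xx]; apply: (@component_full_connected _ x).
apply/eqP; rewrite eqEsubset component_sub; apply/subsetP => y yY.
have := YX y yY; rewrite mem_mclosure => /(lspan_nonorth cfg)[z zX yz].
rewrite -(component_eq cfg (subsetP Xx z zX)).
by apply: component_adjacent => //; [exact: (subsetP XY) | rewrite ipC].
Qed.

Lemma connected_mclosure X x : x \in X -> orth_connected X ->
  orth_connected (mclosure M X).
Proof.
move=> xX cX; have XY := subset_mclosure f X.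
apply: (orth_connected_closure XY (subxx _)); exists x; first exact: (subsetP XY).
exact: connected_sub_component.
Qed.

(** Let [wcomp w x] be a member of the antichain with [w x] maximal. The join lies in the flat
    [sublevel w (w x)]; if connected it lies in [wcomp w x], and so does every member, which leaves
    only one. *)
Lemma nested_flag w : (forall x, flat M (sublevel w (w x))) ->
  nested M [set wcomp w x | x in [set: E]].
Proof.
move=> flw; split=> [_ /imsetP[x _ ->]|A AN aA cA].
  split; first by apply/set0Pn; exists x; apply: mem_wcomp.
  have flx := wcomp_flat cfg flw x; split=> //.
  by apply/(mconnectedP cfg flx); apply: wcomp_connected.
move/(mconnectedP cfg (flat_mclosure _ _)) => cJ.
have /card_gt0P[G0 G0A] : (0 < #|A|)%N by apply: ltnW.
have /imsetP[x0 _ G0E] := subsetP AN G0 G0A.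
have x0P : wcomp w x0 \in A by rewrite -G0E.
case: (arg_maxP (P := fun x => wcomp w x \in A) w x0P) => x xA xmax.
have Jle : flat_join M A \subset sublevel w (w x).
  apply: mclosure_flat => //; apply/bigcupsP => G GA.
  have /imsetP[y _ GE] := subsetP AN G GA; rewrite GE in GA *.
  apply/subsetP => z /wcomp_le wz; rewrite inE (le_trans wz) //.
  exact: xmax.
have inJ G : G \in A -> G \subset flat_join M A.
  by move=> GA; apply: subset_trans (subset_mclosure _ _); apply: bigcup_sup.
have Jx : flat_join M A \subset wcomp w x.
  apply: connected_sub_component => //.
  by apply: (subsetP (inJ _ xA)); apply: mem_wcomp.
move: cA; rewrite ltnNge => /negP[]; rewrite -(cards1 (wcomp w x)).
apply: subset_leq_card; apply/subsetP => G GA; rewrite inE; apply/eqP.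
by apply: aA => //; apply: subset_trans (inJ G GA) Jx.
Qed.

Section Nested.
Variable N : {set {set E}}.
Hypothesis nestN : nested M N.

Lemma nested_neq0 G : G \in N -> G != set0.
Proof. by case: nestN => + _ => /[apply] -[]. Qed.

Lemma nested_flat G : G \in N -> flat M G.
Proof. by case: nestN => + _ => /[apply] -[_ []]. Qed.

Lemma nested_connected G : G \in N -> orth_connected G.
Proof.
move=> GN; have flG := nested_flat GN; apply/(mconnectedP cfg flG).
by case: nestN => /(_ G GN)[_ []].
Qed.

Lemma nested_join (A : {set {set E}}) : A \subset N -> antichain A -> (1 < #|A|)%N ->
  ~ orth_connected (mclosure M (\bigcup_(G in A) G)).
Proof.
move=> AN aA cA /(mconnectedP cfg (flat_mclosure _ _)).
by case: nestN => _ /(_ A AN aA cA).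
Qed.

(** A non-orthogonal pair would connect [G :|: H], and hence the join of the antichain formed by [G]
    and [H]. *)
Lemma nested_orth G H : G \in N -> H \in N -> ~~ (G \subset H) -> ~~ (H \subset G) ->
  orth_sets G H.
Proof.
move=> GN HN nGH nHG x y xG yH; apply/eqP/negPn/negP => xy.
have GH : G != H by apply: contraNneq nGH => ->.
apply: (@nested_join [set G; H]); last 1 first.
- rewrite bigcup_setU !big_set1; apply: (@connected_mclosure _ x).
    by rewrite inE xG.
  by apply: orth_connectedU xG yH xy; apply: nested_connected.
- by rewrite subUset !sub1set GN HN.
- move=> K L; rewrite !inE => /orP[]/eqP-> /orP[]/eqP-> //.
    by rewrite (negbTE nGH).
  by rewrite (negbTE nHG).
- by rewrite cards2 GH.
Qed.

Lemma nested_comparable G H x : G \in N -> H \in N -> x \in G -> x \in H ->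
  G \subset H \/ H \subset G.
Proof.
move=> GN HN xG xH; have [GH|nGH] := boolP (G \subset H); first by left.
have [HG|nHG] := boolP (H \subset G); first by right.
case: (orth_self cfg xG) => y yG; rewrite ipC.
exact: (nested_orth GN HN).
Qed.

Lemma nested_above G H x : G \in N -> H \in N -> x \in G :\: below N G -> x \in H ->
  G \subset H.
Proof.
move=> GN HN; rewrite in_setD => /andP[nb xG] xH.
case: (nested_comparable GN HN xG xH) => // HG; apply: contraR nb => nGH.
by apply/bigcupP; exists H => //; rewrite HN properE HG nGH.
Qed.

Lemma nested_maximal (P : pred {set E}) G : P G -> G \in N ->
  exists H, [/\ H \in N, P H, G \subset H &
    forall K, K \in N -> P K -> H \subset K -> K = H].
Proof.
move=> PG GN; have PGN : (fun K => (K \in N) && P K) G by rewrite /= GN.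
have [H /maxsetP[/andP[HN PH] maxH] GH] :=
  maxset_exists (P := fun K => (K \in N) && P K) PGN.
exists H; split=> // K KN PK HK; apply: maxH => //; by rewrite KN.
Qed.

Lemma maximal_orth (P : pred {set E}) H K :
  (forall L, L \in N -> P L -> H \subset L -> L = H) ->
  H \in N -> K \in N -> P K -> ~~ (K \subset H) -> orth_sets H K.
Proof.
move=> maxH HN KN PK nKH; apply: nested_orth => //.
by apply: contra nKH => /(maxH K KN PK) ->.
Qed.

(** If smaller members covered [G], a maximal one among them would be orthogonal to the rest of [G],
    against connectedness. *)
Lemma nested_top G : G \in N -> exists x, x \in G :\: below N G.
Proof.
move=> GN; have [/eqP|[x xG]] := set_0Vmem (G :\: below N G); last by exists x.
rewrite setD_eq0 => /subsetP GE; have /set0Pn[x xG] := nested_neq0 GN.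
have /bigcupP[H0 /andP[H0N H0G] xH0] := GE x xG.
have [H [HN HG HH maxH]] := nested_maximal (P := fun K => K \proper G) H0G H0N.
have := proper_neq HG; rewrite (nested_connected GN (A := H)) ?eqxx //.
- exact: proper_sub.
- by apply/set0Pn; exists x; apply: (subsetP HH).
move=> y z yH; rewrite in_setD => /andP[zH zG].
have /bigcupP[K /andP[KN KG] zK] := GE z zG.
apply: (maximal_orth maxH HN KN KG) => //.
by apply: contra zH => /subsetP; apply.
Qed.

Section Union.
Variable X : {set E}.
Hypothesis unionX : forall x, x \in X ->
  exists2 G, G \in N & (x \in G) && (G \subset X).

(** A maximal member inside [X] is orthogonal to the rest of [X], so it is a component. *)
Lemma nested_union_component x : x \in X -> component X x \in N.
Proof.
move=> xX; have [G0 G0N /andP[xG0 G0X]] := unionX xX.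
have [G [GN GX G0G maxG]] := nested_maximal (P := fun K => K \subset X) G0X G0N.
rewrite (component_unique _ _ _ (G := G)) ?(subsetP G0G) //.
  exact: nested_connected.
move=> y z yG; rewrite in_setD => /andP[zG zX].
have [K KN /andP[zK KX]] := unionX zX.
apply: (maximal_orth maxG GN KN KX) => //.
by apply: contra zG => /subsetP; apply.
Qed.

(** Suppose [z] is in the span of [X] but not in [X], and let [A] be the set of components of [X]
    not orthogonal to [z]. Then [z] is in the span of their union. Two or more of them would have a
    connected join, linked through [z]; a single one is a flat and already contains [z]. *)
Lemma nested_union_flat : flat M X.
Proof.
apply/flatP => z zX; apply/negPn/negP => nzX.
pose A := [set component X y | y in X & ip (f z) (f y) != 0].
pose Y := \bigcup_(G in A) G.
have YP y : y \in X -> ip (f z) (f y) != 0 -> component X y \in A.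
  by move=> yX yz; apply: imset_f; rewrite inE yX.
have YX : Y \subset X by apply/bigcupsP => _ /imsetP[y _ ->]; apply: component_sub.
have oY : orth_sets Y (X :\: Y).
  move=> u v /bigcupP[_ /imsetP[y yA ->] uy]; rewrite in_setD => /andP[nvY vX].
  apply: (@component_orth _ _ _ f ip X y) => //; rewrite in_setD vX andbT.
  by apply: contra nvY => vy; apply/bigcupP; exists (component X y); rewrite ?imset_f.
have ozY : orth_sets [set z] (X :\: Y).
  move=> _ y /set1P -> ; rewrite in_setD => /andP[nyY yX].
  apply/eqP; apply: contraNT nyY => zy; apply/bigcupP.
  by exists (component X y); [exact: YP | exact: mem_component].
have zY : f z \in lspan Y.
  move: zX; rewrite -(setID X Y) (setIidPr YX) lspanU => /memv_addP[u uY [u' u'Y zE]].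
  (* The part of [f z] outside [Y] is orthogonal to [f z] and to the part in [Y], hence to
     itself. *)
  suff u'0 : u' = 0 by rewrite zE u'0 addr0.
  apply: (config_eq0 cfg).
  have : ip (f z) u' = 0.
    by apply: (orth_lspan cfg ozY) => //; apply: mem_lspan; rewrite inE.
  by rewrite zE (configDl cfg) (orth_lspan cfg oY uY u'Y) add0r.
have [y0 y0Y zy0] := lspan_nonorth cfg zY; have y0X := subsetP YX y0 y0Y.
have AN : A \subset N.
  apply/subsetP => _ /imsetP[y + ->]; rewrite inE => /andP[yX _].
  exact: nested_union_component.
have aA : antichain A.
  move=> _ _ /imsetP[y + ->] /imsetP[y' _ ->]; rewrite inE => /andP[yX _] /subsetP yy'.
  exact: (component_eq cfg (yy' y (mem_component f ip yX))).
have [A1|A1] := ltnP 1 #|A|.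
  apply: (nested_join AN aA A1); rewrite -/Y.
  have YJ := subset_mclosure f Y; apply: (orth_connected_closure YJ (subxx _)).
  have zJ : z \in mclosure M Y by rewrite mem_mclosure.
  exists z => //; apply/bigcupsP => G GA; have /imsetP[y + GE] := GA.
  rewrite inE => /andP[yX zy]; have yG : y \in G by rewrite GE mem_component.
  have GJ : G \subset mclosure M Y by apply: subset_trans YJ; apply: bigcup_sup.
  have yz : y \in component (mclosure M Y) z.
    by apply: component_adjacent => //; apply: (subsetP GJ).
  rewrite -(component_eq cfg yz); apply: connected_sub_component => //.
  by rewrite GE; apply: component_connected.
have AE : A = [set component X y0].
  by apply/esym/eqP; rewrite eqEcard sub1set YP //= cards1.
case/negP: nzX; move: zY; rewrite /Y AE big_set1 => zy.
apply: (subsetP (component_sub f ip X y0)).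
by apply: (flatP _ _ (nested_flat (nested_union_component y0X))).
Qed.

End Union.
End Nested.
End NestedSets.

(** * Weights built from a nested set, and their uniqueness *)

Section NestedWeights.
Variables (R : realType) (V : vectType R) (E : finType) (f : E -> V).
Variable ip : V -> V -> R.
Hypothesis cfg : root_configuration f ip.
Implicit Types (A B C D F G H I J X Y : {set E}) (x y z : E).
Implicit Types w : {ffun E -> R}.
Local Notation M := (vector_matroid f).
Local Notation component := (component f ip).
Local Notation orth_connected := (orth_connected f ip).
Local Notation wcomp := (wcomp f ip).

Definition component_constant (l : E -> R) :=
  forall x y, component [set: E] x = component [set: E] y -> l x = l y.

Lemma component_in_components x : component [set: E] x \in components M.
Proof. by rewrite (componentsE cfg) imset_f ?inE. Qed.

Lemma mem_componentT x : x \in component [set: E] x.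
Proof. by apply: mem_component; rewrite inE. Qed.

Lemma connected_same_component G x y : orth_connected G -> x \in G -> y \in G ->
  component [set: E] x = component [set: E] y.
Proof.
move=> cG xG yG; apply/esym; apply: (component_eq cfg).
by apply: (subsetP (connected_sub_component cG (subsetT G) xG)).
Qed.

Lemma components_maximal G C : C \in components M -> orth_connected G ->
  C \subset G -> G = C.
Proof.
rewrite (componentsE cfg) => /imsetP[x _ ->] cG xG.
apply/eqP; rewrite eqEsubset xG andbT.
by apply: connected_sub_component; rewrite ?subsetT // (subsetP xG) // mem_componentT.
Qed.

Section Nested.
Variable N : {set {set E}}.
Hypotheses (nestN : nested M N) (compN : components M \subset N).
Local Notation NV := (N :\: components M).

Lemma in_proper_members G : G \in NV -> G \in N.
Proof. by rewrite in_setD => /andP[]. Qed.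

Lemma proper_member G H : G \in N -> H \in N -> G \proper H -> G \in NV.
Proof.
move=> GN HN GH; rewrite in_setD GN andbT; apply/negP => Gc.
have HG := components_maximal Gc (nested_connected cfg nestN HN) (proper_sub GH).
by rewrite HG properxx in GH.
Qed.

Lemma nested_cover x : exists2 G, G \in N & x \in G :\: below N G.
Proof.
have P0 : (fun G : {set E} => (G \in N) && (x \in G)) (component [set: E] x).
  by rewrite /= mem_componentT (subsetP compN) // component_in_components.
have [G /minsetP[/andP[GN xG] minG] _] :=
  minset_exists (P := fun G : {set E} => (G \in N) && (x \in G)) P0.
exists G => //; rewrite in_setD xG andbT; apply/negP => /bigcupP[H /andP[HN HG] xH].
have HE : H = G by apply: minG; rewrite ?HN // proper_sub.
by rewrite HE properxx in HG.
Qed.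

Section Positive.
Variables (a : {set E} -> R) (l : E -> R) (w : {ffun E -> R}).
Hypotheses (a_gt0 : forall G, G \in NV -> 0 < a G) (l_const : component_constant l).
Hypothesis wE : forall x, w x = l x - \sum_(G in NV) a G * (x \in G)%:R.

(** Each member through [x] contains [G], hence [y]: every amount subtracted at [x] is subtracted at
    [y] too. *)
Lemma nested_weight_le G x y : G \in N -> x \in G :\: below N G -> y \in G ->
  w y <= w x.
Proof.
move=> GN xG yG; rewrite !wE (l_const (y := x)); last first.
  apply: connected_same_component (nested_connected cfg nestN GN) _ _ => //.
  by move: xG; rewrite in_setD => /andP[].
rewrite lerD2l lerN2; apply: ler_sum => H HN; rewrite ler_pM2l ?a_gt0 // ler_nat.
case: (boolP (x \in H)) => // xH.
by rewrite (subsetP (nested_above cfg nestN GN (in_proper_members HN) xG xH)).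
Qed.

Lemma nested_weight_union t x : x \in sublevel w t ->
  exists2 G, G \in N & (x \in G) && (G \subset sublevel w t).
Proof.
rewrite inE => xt; have [G GN xG] := nested_cover x; exists G => //.
apply/andP; split; first by move: xG; rewrite in_setD => /andP[].
apply/subsetP => y yG; rewrite inE; apply: le_trans xt.
exact: nested_weight_le xG yG.
Qed.

Lemma nested_weight_flat t : flat M (sublevel w t).
Proof. exact: (nested_union_flat cfg nestN (@nested_weight_union t)). Qed.

Lemma nested_weight_wcomp : [set wcomp w x | x in [set: E]] = N.
Proof.
have inN x : wcomp w x \in N.
  apply: (nested_union_component cfg nestN (@nested_weight_union (w x))).
  by rewrite inE.
apply/eqP; rewrite eqEsubset; apply/andP; split.
  by apply/subsetP => _ /imsetP[x _ ->].
apply/subsetP => G GN; have [x xG] := nested_top cfg nestN GN.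
apply/imsetP; exists x => //; set H := wcomp w x.
have HN : H \in N := inN x.
have GH : G \subset H.
  exact: (nested_above cfg nestN GN HN xG (mem_wcomp f ip w x)).
apply/eqP; apply/negPn/negP => nGH.
have pGH : G \proper H by rewrite properEneq nGH.
have GV := proper_member GN HN pGH.
have [y yH] := nested_top cfg nestN HN.
have /andP[nyb yH'] : (y \notin below N H) && (y \in H) by rewrite -in_setD.
have xG' : x \in G by move: xG; rewrite in_setD => /andP[].
(* This is contradicted: members through [y] contain [H], hence [x], while [G] contains [x] but not
   [y], so at least [a G] more is subtracted at [x]. *)
have : w y <= w x by apply: (@wcomp_le _ _ _ f ip).
rewrite leNgt => /negP[]; rewrite !wE (l_const (y := y)); last first.
  apply: connected_same_component (nested_connected cfg nestN HN) _ _ => //.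
  exact: (subsetP GH).
rewrite ltrD2l ltrN2 (bigD1 G) //= [ltRHS](bigD1 G) //= xG'.
have -> : y \in G = false.
  by apply: contraNF nyb => yG; apply/bigcupP; exists G; rewrite ?GN.
rewrite mulr0 mulr1 ltr_leD ?a_gt0 //; apply: ler_sum => K /andP[KN _].
rewrite ler_pM2l ?a_gt0 // ler_nat; case: (boolP (y \in K)) => // yK.
have HK := nested_above cfg nestN HN (in_proper_members KN) yH yK.
by rewrite (subsetP HK) // (subsetP GH).
Qed.

End Positive.

(** At a top point of a component of [M] all terms vanish, so [l] is zero. At a top point of a
    maximal [G] with [a G != 0] only the term of [G] is left. *)
Lemma nested_independent (a : {set E} -> R) (l : E -> R) : component_constant l ->
  (forall x, \sum_(G in NV) a G * (x \in G)%:R = l x) ->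
  forall G, G \in NV -> a G = 0.
Proof.
move=> l_const sumE.
have l0 x : l x = 0.
  have CN := subsetP compN _ (component_in_components x).
  have [y yC] := nested_top cfg nestN CN.
  have yx : y \in component setT x by move: yC; rewrite in_setD => /andP[].
  rewrite (l_const x y); last by rewrite (component_eq cfg yx).
  rewrite -sumE big1 // => G GV; have [yG|] := boolP (y \in G); last by rewrite mulr0.
  have GN := in_proper_members GV.
  have CG := nested_above cfg nestN CN GN yC yG.
  move: GV; rewrite in_setD.
  have cG := nested_connected cfg nestN GN.
  rewrite (components_maximal (component_in_components x) cG CG).
  by rewrite component_in_components.
move=> G0 G0V; apply/eqP/negPn/negP => a0.
have [G [GN /andP[GV aG] _ maxG]] :=
  nested_maximal (N := N) (P := fun K => (K \in NV) && (a K != 0)) (G := G0)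
    (introT andP (conj G0V a0)) (in_proper_members G0V).
have [x xG] := nested_top cfg nestN GN.
have xG' : x \in G by move: xG; rewrite in_setD => /andP[].
have := sumE x; rewrite l0 (bigD1 G) //= xG' mulr1 big1 ?addr0.
  by move/eqP; rewrite (negbTE aG).
move=> H /andP[HV HG]; have [xH|] := boolP (x \in H); last by rewrite mulr0.
have [->|aH] := eqVneq (a H) 0; first by rewrite mul0r.
have HN := in_proper_members HV.
have GH := nested_above cfg nestN GN HN xG xH.
by rewrite (maxG H) ?HV // eqxx in HG.
Qed.

End Nested.

(** * Every weight with flat sublevel sets comes from its nested set *)

Section Representation.
Variable w : {ffun E -> R}.
Hypothesis flw : forall x, flat M (sublevel w (w x)).
Let N := [set wcomp w x | x in [set: E]].
Local Notation NV := (N :\: components M).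

Let nestN : nested M N := nested_flag cfg flw.

Definition top_value G : R := if [pick x | wcomp w x == G] is Some x then w x else 0.

Lemma top_value_wcomp x : top_value (wcomp w x) = w x.
Proof.
rewrite /top_value; case: pickP => [y /eqP yx|/(_ x)]; last by rewrite eqxx.
apply/le_anti; rewrite !(@wcomp_le _ _ _ f ip) //; first by rewrite yx mem_wcomp.
by rewrite -yx mem_wcomp.
Qed.

Lemma exists_parent G : G \in NV -> exists P, [/\ P \in N, G \proper P &
  forall H, H \in N -> G \proper H -> P \subset H].
Proof.
move=> GV; have GN := in_proper_members GV.
have /set0Pn[x xG] := nested_neq0 nestN GN.
have P0 : (fun H => (H \in N) && (G \proper H)) (component [set: E] x).
  rewrite /= (subsetP (components_wcomp cfg w)) ?component_in_components //=.
  have cG := nested_connected cfg nestN GN.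
  rewrite properEneq (connected_sub_component cG) ?subsetT //.
  rewrite andbT; apply: contraTneq GV => ->.
  by rewrite in_setD component_in_components.
have [P /minsetP[/andP[PN GP] minP] _] :=
  minset_exists (P := fun H => (H \in N) && (G \proper H)) P0.
exists P; split=> // H HN GH.
have xP : x \in P by apply: (subsetP (proper_sub GP)).
have xH : x \in H by apply: (subsetP (proper_sub GH)).
case: (nested_comparable cfg nestN PN HN xP xH) => // HP.
by rewrite (minP H) // HN.
Qed.

(* The coefficient of a member [G] is the jump from the value of [w] on the top
   of [G] to its value on the top of the next larger member. *)
Lemma weight_representation : exists (a : {set E} -> R) (l : E -> R),
  [/\ forall G, G \in NV -> 0 < a G, component_constant l &
      forall x, w x = l x - \sum_(G in NV) a G * (x \in G)%:R].
Proof.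
have /choice[p pP] : forall G, exists P, G \in NV -> [/\ P \in N, G \proper P &
    forall H, H \in N -> G \proper H -> P \subset H].
  move=> G; have [GV|] := boolP (G \in NV); last by exists G.
  by have [P PP] := exists_parent GV; exists P.
pose a G := top_value (p G) - top_value G.
pose l x := top_value (component [set: E] x).
have inN x : wcomp w x \in N by rewrite imset_f ?inE.
have memN x H : H \in N -> (x \in H) = (wcomp w x \subset H).
  move=> /imsetP[y _ ->]; apply/idP/idP; first exact: wcompS.
  by move/subsetP; apply; apply: mem_wcomp.
exists a, l; split=> [G GV|x y xy|]; [|by rewrite /l xy|].
  have [/imsetP[y _ PE] GP _] := pP G GV.
  have /imsetP[x _ GE] := in_proper_members GV.
  rewrite /a PE GE !top_value_wcomp subr_gt0.
  have xy : x \in wcomp w y by rewrite -PE (subsetP (proper_sub GP)) // GE mem_wcomp.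
  rewrite ltNge; apply/negP => /(wcomp_eq cfg xy) xyE.
  by rewrite PE GE xyE properxx in GP.
suff tele x : w x = l x - \sum_(H in NV | wcomp w x \subset H) a H.
  move=> x; rewrite (tele x); congr (_ - _).
  rewrite big_mkcondr; apply: eq_bigr => H HV.
  rewrite -(memN x H (in_proper_members HV)).
  by case: (x \in H); rewrite ?mulr1 ?mulr0.
(* The members containing [wcomp w x] form a chain of successive parents, along which the sum
   telescopes; the induction passes to the parent, whose complement is smaller. *)
have [n] := ubnP #|~: wcomp w x|; elim: n x => // n IHn x; rewrite ltnS => nx.
have sub_comp : wcomp w x \subset component [set: E] x.
  apply: connected_sub_component (subsetT _) (mem_wcomp _ _ _ _).
  exact: wcomp_connected.
have [xC|xC] := boolP (wcomp w x \in components M).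
  rewrite /l (components_maximal xC (@component_connected _ _ _ _ _ cfg _ _) sub_comp).
  rewrite top_value_wcomp big1 ?subr0 // => H /andP[HV xH].
  have cH := nested_connected cfg nestN (in_proper_members HV).
  by move: HV; rewrite in_setD (components_maximal xC cH xH) xC.
have GV : wcomp w x \in NV by rewrite in_setD xC inN.
have [PN GP Pmin] := pP _ GV; have /imsetP[y _ PE] := PN.
have xP : x \in p (wcomp w x) by apply: (subsetP (proper_sub GP)); apply: mem_wcomp.
have yP : y \in p (wcomp w x) by rewrite PE mem_wcomp.
have wy : w y = l x - \sum_(H in NV | p (wcomp w x) \subset H) a H.
  rewrite PE (IHn y) -?PE; last first.
    by apply: leq_trans nx; apply: proper_card; rewrite properC.
  congr (_ - _); congr top_value.
  exact: connected_same_component (nested_connected cfg nestN PN) yP xP.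
rewrite (bigD1 (wcomp w x)) /=; last by rewrite GV subxx.
have -> : \sum_(H | (H \in NV) && (wcomp w x \subset H) && (H != wcomp w x)) a H =
    \sum_(H in NV | p (wcomp w x) \subset H) a H.
  apply: eq_bigl => H; rewrite -andbA; case: (boolP (H \in NV)) => //= HV.
  apply/idP/idP => [/andP[xH nxH]|PH].
    by apply: Pmin (in_proper_members HV) _; rewrite properEneq eq_sym nxH.
  rewrite (subset_trans (proper_sub GP) PH) /=.
  by apply: contraTneq PH => ->; move: GP; rewrite properE => /andP[].
have -> : a (wcomp w x) = w y - w x by rewrite /a PE !top_value_wcomp.
by rewrite {}wy opprD opprB addrA addrAC [in RHS]addrC subrK.
Qed.

End Representation.
End NestedWeights.

From mathcomp Require Import classical_sets cardinality.

(** * Comparison of the subdivisions and realization of the nested set complex *)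

Section SimplicialComplex.
Variables (R : realType) (V : vectType R) (E : finType) (f : E -> V).
Variable ip : V -> V -> R.
Hypothesis cfg : root_configuration f ip.
Implicit Types (G H : {set E}) (x y : E) (N : {set {set E}}) (w : {ffun E -> R}).
Local Notation M := (vector_matroid f).
Local Notation component := (component f ip).
Local Notation wcomp := (wcomp f ip).

Lemma bergmanP w : bergman M w <-> unit_sphere w /\ forall x, flat M (sublevel w (w x)).
Proof. by split=> -[? /(flag_of_flatsP cfg)]. Qed.

Lemma flag_matroid_components w (v : {ffun E -> R}) : bergman M w -> bergman M v ->
  flag_matroid M (level_flag w) = flag_matroid M (level_flag v) <->
  flag_components M (level_flag w) = flag_components M (level_flag v).
Proof.
move=> /bergmanP[_ flw] /bergmanP[_ flv].
rewrite (flag_componentsE cfg flw) (flag_componentsE cfg flv).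
exact: flag_matroid_wcomp.
Qed.

Lemma coarse_nested_subdivision : coarse_subdivision R M = nested_set_complex R M.
Proof.
have cells w : bergman M w ->
    coarse_cell M (flag_matroid M (level_flag w)) =
    nested_cell M (flag_components M (level_flag w)) :> set {ffun E -> R}.
  move=> bw; apply/seteqP; split=> v [bv vE]; split=> //.
    exact/(flag_matroid_components bv bw).
  exact/(flag_matroid_components bv bw).
apply/seteqP; split=> C [C0 [N]].
  move=> CE; split=> //; have /eqP/set0P[w wC] := C0.
  move: wC; rewrite {1}CE => -[bw wN].
  exists (flag_components M (level_flag w)).
  have /bergmanP[_ flw] := bw.
  split; last by rewrite CE -wN cells.
    by rewrite (flag_componentsE cfg flw); apply: nested_flag.
  by rewrite (flag_componentsE cfg flw); apply: components_wcomp.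
move=> [nN cN CE]; split=> //; have /eqP/set0P[w wC] := C0.
move: wC; rewrite {1}CE => -[bw wN].
by exists (flag_matroid M (level_flag w)); rewrite cells // CE wN.
Qed.

(** Components of [M] belong to every nested set that indexes a cell; they account for the lineality
    space and are not vertices. *)
Definition is_vertex : pred {set E} := fun G =>
  [&& G != finset.set0, flat M G, `[< orth_connected f ip G >] & G \notin components M].

Definition vertex := {G : {set E} | is_vertex G}.

(** Euclidean norm of the indicator of [G] projected to the hyperplane of sum zero. *)
Definition vertex_norm G : R :=
  Num.sqrt (#|G|%:R - #|G|%:R ^+ 2 / #|E|%:R).

(** The negated indicator of [G], projected to the hyperplane of sum zero and normalized. The sign
    reflects that smaller flats of a flag carry smaller weights. *)
Definition vertex_vector (v : vertex) : {ffun E -> R} :=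
  [ffun x => (#|val v|%:R / #|E|%:R - (x \in val v)%:R) / vertex_norm (val v)].

Definition members (sigma : {set vertex}) : {set {set E}} :=
  components M :|: [set val v | v in sigma].

Definition nested_faces : {set {set vertex}} :=
  [set sigma | `[< nested M (members sigma) >]].

Lemma nested_facesP sigma : reflect (nested M (members sigma)) (sigma \in nested_faces).
Proof. by rewrite inE; apply: asboolP. Qed.

Lemma sum_indicator G : \sum_x (x \in G)%:R = #|G|%:R :> R.
Proof.
rewrite -sum1_card natr_sum [RHS]big_mkcond /=.
by apply: eq_bigr => x _; case: ifP.
Qed.

(** A connected set equal to the whole ground set would be a component of [M]. Both strict bounds
    are needed for a nonzero norm. *)
Lemma vertex_card (v : vertex) : (0 < #|val v| < #|E|)%N.
Proof.
case: v => G /= /and4P[G0 _ /asboolP cG Gc]; rewrite card_gt0 G0 /=.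
have /finset.set0Pn[x xG] := G0.
have := max_card (mem G); rewrite leq_eqVlt => /orP[/eqP GE|//].
have GT : G = [set: E]%SET.
  by apply/eqP; rewrite eqEcard finset.subsetT cardsT GE leqnn.
case/negP: Gc; rewrite -(component_unique cfg (F := [set: E]%SET) cG (x := x)) //.
- exact: component_in_components.
- by rewrite GT finset.setDv => y z _; rewrite inE.
Qed.

Lemma vertex_norm_gt0 (v : vertex) : 0 < vertex_norm (val v).
Proof.
have /andP[v0 vE] := vertex_card v; rewrite sqrtr_gt0 subr_gt0.
have n0 : (0 : R) < #|E|%:R by rewrite ltr0n; apply: leq_ltn_trans vE.
by rewrite ltr_pdivrMr // expr2 ltr_pM2l ?ltr0n // ltr_nat.
Qed.

Lemma vertex_vector_sum (v : vertex) : \sum_x vertex_vector v x = 0.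
Proof.
have /andP[_ vE] := vertex_card v.
under eq_bigr => x _ do rewrite ffunE.
rewrite -mulr_suml big_split /= sumrN sum_indicator sumr_const -[_ *+ _]mulr_natr.
rewrite divfK ?subrr ?mul0r // pnatr_eq0 -lt0n; exact: leq_ltn_trans vE.
Qed.

Lemma vertex_vector_unit (v : vertex) : unit_sphere (vertex_vector v).
Proof.
split; first exact: vertex_vector_sum.
have /andP[_ vE] := vertex_card v; have vn := vertex_norm_gt0 v.
have n0 : (#|E|%:R : R) != 0 by rewrite pnatr_eq0 -lt0n; apply: leq_ltn_trans vE.
under eq_bigr => x _ do rewrite ffunE expr_div_n.
rewrite -mulr_suml sqr_sqrtr; last by move: vn; rewrite sqrtr_gt0 => /ltW.
set q := _ - _ / _.
suff -> : \sum_x (#|val v|%:R / #|E|%:R - (x \in val v)%:R) ^+ 2 = q.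
  by rewrite divff // gt_eqF //; move: vn; rewrite sqrtr_gt0.
have sq x : (#|val v|%:R / #|E|%:R - (x \in val v)%:R) ^+ 2 =
    (#|val v|%:R / #|E|%:R) ^+ 2
    + (1 - 2 * (#|val v|%:R / #|E|%:R)) * (x \in val v)%:R :> R.
  by move: (_ / _) => t; case: (x \in val v) => /=; ring.
under eq_bigr => x _ do rewrite sq.
rewrite big_split /= sumr_const -mulr_sumr sum_indicator -[_ *+ _]mulr_natr /q.
by field.
Qed.

Lemma members_vertices sigma :
  members sigma :\: components M = [set val v | v in sigma].
Proof.
apply/finset.setP => G; rewrite finset.in_setD finset.in_setU.
have [Gc|] := boolP (G \in components M) => //=; apply/esym/negbTE/imsetP => -[v _ GE].
by have := valP v; rewrite /is_vertex /= -GE Gc !andbF.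
Qed.

Lemma sum_members sigma (F : {set E} -> R) :
  \sum_(G in members sigma :\: components M) F G = \sum_(v in sigma) F (val v).
Proof. by rewrite members_vertices big_imset //= => u v _ _; apply: val_inj. Qed.

Lemma members_inj sigma tau : members sigma = members tau -> sigma = tau.
Proof.
move=> eqm; have eqv : [set val v | v in sigma] = [set val v | v in tau].
  by rewrite -!members_vertices eqm.
apply/finset.setP => v; rewrite -(mem_imset _ _ val_inj) eqv.
by rewrite (mem_imset _ _ val_inj).
Qed.

Lemma nestedS N N' : N' \subset N -> nested M N -> nested M N'.
Proof.
move=> sub [N1 N2]; split=> [G /(fintype.subsetP sub)/N1//|A AN].
by apply: N2; apply: fintype.subset_trans AN sub.
Qed.

(** This is the nested set of the zero weight, whose only sublevel set at a value is the ground
    set. *)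
Lemma nested_components : nested M (components M).
Proof.
pose w0 : {ffun E -> R} := [ffun=> 0].
have leT x : sublevel w0 (w0 x) = [set: E]%SET.
  by apply/finset.setP => y; rewrite !inE !ffunE lexx.
have fl0 x : flat M (sublevel w0 (w0 x)) by rewrite leT flatT.
have := nested_flag cfg fl0; rewrite (componentsE cfg).
have -> // : [set wcomp w0 x | x in [set: E]%SET] =
    [set component [set: E]%SET x | x in [set: E]%SET].
by apply: eq_in_imset => x _; rewrite /wcomp leT.
Qed.

Lemma members_of_nested N : nested M N -> components M \subset N ->
  exists2 sigma, sigma \in nested_faces & members sigma = N.
Proof.
move=> nN cN; exists [set v : vertex | val v \in N]; last first.
  apply/finset.setP => G; rewrite finset.in_setU.
  have [Gc|Gc] := boolP (G \in components M); first by rewrite (fintype.subsetP cN).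
  apply/imsetP/idP => [[v + ->]|GN]; first by rewrite inE.
  have vG : is_vertex G.
    rewrite /is_vertex Gc (nested_neq0 nN GN) (nested_flat nN GN) /= andbT.
    by apply/asboolP; apply: nested_connected GN.
  by exists (Sub G vG); rewrite ?inE SubK.
apply/nested_facesP; apply: nestedS nN; rewrite finset.subUset cN /=.
by apply/fintype.subsetP => _ /imsetP[v + ->]; rewrite inE.
Qed.

Lemma component_constantP (l : {ffun E -> R}) :
  lineality R M l <-> \sum_x l x = 0 /\ component_constant f ip l.
Proof.
split=> -[l0 lc]; split=> //.
  move=> x y xy; apply: (lc (component [set: E]%SET x)).
  - exact: component_in_components.
  - exact: mem_componentT.
  - by rewrite xy mem_componentT.
move=> G; rewrite (componentsE cfg) => /imsetP[z _ ->] x y xz yz.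
by apply: lc; rewrite !(component_eq cfg (y := _) (x := z)).
Qed.

Definition extend_coef (a : vertex -> R) G : R := if insub G is Some v then a v else 0.

Lemma extend_coef_val a (v : vertex) : extend_coef a (val v) = a v.
Proof. by rewrite /extend_coef valK. Qed.

(** The projection to sum zero only adds a constant, which can be absorbed in the part constant on
    components. *)
Lemma vertex_combination (sigma : {set vertex}) (a : vertex -> R) x :
  \sum_(v in sigma) a v * vertex_vector v x =
  \sum_(v in sigma) a v / vertex_norm (val v) * (#|val v|%:R / #|E|%:R)
  - \sum_(G in members sigma :\: components M)
      extend_coef (fun v => a v / vertex_norm (val v)) G * (x \in G)%:R.
Proof.
rewrite sum_members -sumrB; apply: eq_bigr => v _.
by rewrite extend_coef_val ffunE; ring.
Qed.

Lemma open_simplexP sigma w : sigma \in nested_faces ->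
  open_simplex (lineality R M) vertex_vector sigma w <->
  nested_cell M (members sigma) w.
Proof.
move=> /nested_facesP nS.
have cS : components M \subset members sigma by apply: finset.subsetUl.
split=> [[uw [l [a [/component_constantP[_ lc] a0 wE]]]]|].
  pose k := \sum_(v in sigma) a v / vertex_norm (val v) * (#|val v|%:R / #|E|%:R).
  have wE' x : w x = (l x + k) - \sum_(G in members sigma :\: components M)
      extend_coef (fun v => a v / vertex_norm (val v)) G * (x \in G)%:R.
    by rewrite wE vertex_combination addrA.
  have a0' G : G \in members sigma :\: components M ->
      0 < extend_coef (fun v => a v / vertex_norm (val v)) G.
    rewrite members_vertices => /imsetP[v vs ->].
    by rewrite extend_coef_val divr_gt0 ?a0 ?vertex_norm_gt0.
  have lc' : component_constant f ip (fun x => l x + k).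
    by move=> x y xy; rewrite (lc x y xy).
  have fl := nested_weight_flat cfg nS cS a0' lc' wE'.
  split; first by apply/bergmanP; split.
  rewrite (flag_componentsE cfg (fun x => fl (w x))).
  exact: (nested_weight_wcomp cfg nS cS a0' lc' wE').
move=> [/bergmanP[uw flw]]; rewrite (flag_componentsE cfg flw) => wS.
split=> //.
have [a [l [a0 lc wE]]] := weight_representation cfg flw; rewrite wS in a0 wE.
(* The factor undoes the normalization of the vertices. With [l0] defined as the remainder, the
   decomposition is automatic and its content is that [l0] is constant on components. *)
pose b (v : vertex) := a (val v) * vertex_norm (val v).
pose l0 := [ffun x => w x - \sum_(v in sigma) b v * vertex_vector v x].
exists l0, b; split.
- apply/component_constantP; split.
    under eq_bigr => x _ do rewrite ffunE.
    rewrite sumrB (proj1 uw) exchange_big big1 ?subr0 //= => v _.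
    by rewrite -mulr_sumr vertex_vector_sum mulr0.
  pose k := \sum_(v in sigma) a (val v) * (#|val v|%:R / #|E|%:R).
  suff lE x : l0 x = l x - k by move=> x y xy; rewrite !lE (lc x y xy).
  rewrite ffunE vertex_combination wE !sum_members.
  have bE v : b v / vertex_norm (val v) = a (val v).
    by rewrite /b mulfK ?gt_eqF ?vertex_norm_gt0.
  under [X in _ - (X - _)]eq_bigr => v _ do rewrite bE.
  under [X in _ - (_ - X)]eq_bigr => v _ do rewrite extend_coef_val bE.
  by rewrite opprB addrA subrK.
- move=> v vs; rewrite mulr_gt0 ?vertex_norm_gt0 ?a0 //.
  by rewrite members_vertices imset_f.
- by move=> x; rewrite ffunE subrK.
Qed.

Lemma nested_simplicial_complex :
  simplicial_complex_mod (lineality R M) (nested_set_complex R M).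
Proof.
exists vertex, vertex_vector, nested_faces; split.
  have sub (sigma tau : {set vertex}) :
      tau \subset sigma -> sigma \in nested_faces -> tau \in nested_faces.
    move=> st /nested_facesP nS; apply/nested_facesP; apply: nestedS nS.
    by apply: finset.setUS; apply: imsetS.
  split=> //; apply/nested_facesP.
  by rewrite /members imset0 finset.setU0; apply: nested_components.
split.
- exact: vertex_vector_unit.
- move=> sigma a l /nested_facesP nS /component_constantP[_ lc] sumE v vs.
  have cS : components M \subset members sigma by apply: finset.subsetUl.
  pose k := \sum_(v in sigma) a v / vertex_norm (val v) * (#|val v|%:R / #|E|%:R).
  have lc' : component_constant f ip (fun x => k - l x).
    by move=> x y xy; rewrite (lc x y xy).
  have sumE' x : \sum_(G in members sigma :\: components M)
      extend_coef (fun v => a v / vertex_norm (val v)) G * (x \in G)%:R = k - l x.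
    by rewrite -sumE vertex_combination opprB addrC subrK.
  have := nested_independent cfg nS cS lc' sumE' (G := val v).
  rewrite members_vertices imset_f // extend_coef_val => /(_ isT)/eqP.
  by rewrite mulf_eq0 invr_eq0 (gt_eqF (vertex_norm_gt0 v)) orbF => /eqP.
- move=> sigma tau w sK tK /(open_simplexP _ sK)[_ sE] /(open_simplexP _ tK)[_ tE].
  by apply: members_inj; rewrite -sE -tE.
- move=> C; split=> [[C0 [N [nN cN CE]]]|[C0 [sigma sK CE]]]; split=> //.
    have [sigma sK sN] := members_of_nested nN cN; exists sigma => //.
    by rewrite CE -sN; apply/seteqP; split=> w; rewrite open_simplexP.
  exists (members sigma); split.
  + exact/nested_facesP.
  + exact: finset.subsetUl.
  + by rewrite CE; apply/seteqP; split=> w; rewrite open_simplexP.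
Qed.

End SimplicialComplex.

(** * Linear automorphisms as a group *)

Section LinearAutomorphisms.
Variables (K : fieldType) (V : vectType K).

(** The target for the universal property in [coxeter_system], which requires a [groupType]. In
    finite dimension a trivial kernel gives invertibility. *)
Definition lin_aut := {g : 'End(V) | lker g == 0%VS}.

HB.instance Definition _ := Choice.on lin_aut.

Fact lin_aut1_subproof : lker (\1 : 'End(V))%VF == 0%VS.
Proof. by apply/lker0P => u v; rewrite !id_lfunE. Qed.

Fact lin_autM_subproof (g h : lin_aut) : lker (val g \o val h)%VF == 0%VS.
Proof.
apply/lker0P => u v; rewrite !comp_lfunE => /(lker0P (valP g)).
exact: (lker0P (valP h)).
Qed.

Fact lin_autV_subproof (g : lin_aut) : lker (val g)^-1%VF == 0%VS.
Proof.
apply/lker0P => u v; move/(congr1 (val g)).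
have gK w : val g ((val g)^-1%VF w) = w.
  by rewrite -comp_lfunE lker0_compfV ?id_lfunE // (valP g).
by rewrite !gK.
Qed.

Definition lin_aut1 : lin_aut := exist _ \1%VF lin_aut1_subproof.
Definition lin_autM (g h : lin_aut) : lin_aut :=
  exist _ (val g \o val h)%VF (lin_autM_subproof g h).
Definition lin_autV (g : lin_aut) : lin_aut :=
  exist _ ((val g)^-1)%VF (lin_autV_subproof g).

Fact lin_autMA : associative lin_autM.
Proof. by move=> g h k; apply: val_inj; rewrite /= comp_lfunA. Qed.

Fact lin_aut1M : left_id lin_aut1 lin_autM.
Proof. by move=> g; apply: val_inj; rewrite /= comp_lfun1l. Qed.

Fact lin_autM1 : right_id lin_aut1 lin_autM.
Proof. by move=> g; apply: val_inj; rewrite /= comp_lfun1r. Qed.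

Fact lin_autVM : left_inverse lin_aut1 lin_autV lin_autM.
Proof. by move=> g; apply: val_inj; rewrite /= lker0_compVf ?(valP g). Qed.

Fact lin_autMV : right_inverse lin_aut1 lin_autV lin_autM.
Proof. by move=> g; apply: val_inj; rewrite /= lker0_compfV ?(valP g). Qed.

HB.instance Definition _ :=
  isGroup.Build lin_aut lin_autMA lin_aut1M lin_autM1 lin_autVM lin_autMV.

Lemma lin_autME (g h : lin_aut) v : val (g * h)%g v = val g (val h v).
Proof. by rewrite [val _]/= comp_lfunE. Qed.

Lemma lin_aut1E v : val (1%g : lin_aut) v = v.
Proof. by rewrite [val _]/= id_lfunE. Qed.

Lemma lin_autXE (g : lin_aut) n v : val (g ^+ n)%g v = iter n (val g) v.
Proof. by elim: n => [|n IHn]; rewrite ?lin_aut1E // expgS lin_autME IHn. Qed.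

End LinearAutomorphisms.

(** * The reflections on the geometric space and the dihedral relations *)

Section GeometricRepresentation.
Variables (R : realType) (S : finType) (m : S -> S -> nat).
Hypothesis cox : coxeter_matrix m.
Local Notation V := (geom_space R S).
Local Notation form := (@geom_form R S m).
Local Notation alpha := (@simple_root R S).
Local Notation refl := (@simple_reflection R S m).
Local Notation act := (@word_action R S m).
Implicit Types (s t : S) (u v : V) (w : seq S) (k n : nat).

Lemma geom_formDl u u' v : form (u + u') v = form u v + form u' v.
Proof.
rewrite /geom_form -big_split; apply: eq_bigr => s _; rewrite -big_split.
by apply: eq_bigr => t _; rewrite !ffunE !mulrDl.
Qed.

Lemma geom_formZl a u v : form (a *: u) v = a * form u v.
Proof.
rewrite /geom_form mulr_sumr; apply: eq_bigr => s _; rewrite mulr_sumr.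
by apply: eq_bigr => t _; rewrite !ffunE -!mulrA.
Qed.

Lemma geom_formC u v : form u v = form v u.
Proof.
have [_ mC _] := cox; rewrite /geom_form exchange_big; apply: eq_bigr => s _.
by apply: eq_bigr => t _; rewrite mC (mulrC (u t)).
Qed.

Lemma geom_formDr u v v' : form u (v + v') = form u v + form u v'.
Proof. by rewrite geom_formC geom_formDl !(geom_formC u). Qed.

Lemma geom_formZr a u v : form u (a *: v) = a * form u v.
Proof. by rewrite geom_formC geom_formZl (geom_formC u). Qed.

Lemma form_simple s t : form (alpha s) (alpha t) = - cos (pi / (m s t)%:R).
Proof.
rewrite /geom_form (bigD1 s) //= (bigD1 t) //= !ffunE !eqxx !mul1r.
rewrite big1 ?addr0 => [|t' /negbTE nt]; last by rewrite ffunE nt mulr0 mul0r.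
rewrite big1 ?addr0 // => s' /negbTE ns; rewrite big1 // => t' _.
by rewrite ffunE ns !mul0r.
Qed.

Lemma form_simple1 s : form (alpha s) (alpha s) = 1.
Proof. by have [m1 _ _] := cox; rewrite form_simple m1 divr1 cospi opprK. Qed.

Lemma reflD s u v : refl s (u + v) = refl s u + refl s v.
Proof.
rewrite /simple_reflection geom_formDl mulrDr scalerDl opprD.
by rewrite addrACA.
Qed.

Lemma reflZ s a u : refl s (a *: u) = a *: refl s u.
Proof. by rewrite /simple_reflection geom_formZl scalerBr scalerA mulrCA. Qed.

Lemma refl_simple s : refl s (alpha s) = - alpha s.
Proof.
rewrite /simple_reflection form_simple1 mulr1 scaler_nat mulr2n opprD addrA.
by rewrite subrr add0r.
Qed.

Lemma reflK s : involutive (refl s).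
Proof.
move=> v; rewrite {2}/simple_reflection reflD -scaleNr reflZ refl_simple.
by rewrite /simple_reflection scalerN scaleNr opprK subrK.
Qed.

Lemma form_refl s u v : form (refl s u) (refl s v) = form u v.
Proof.
rewrite /simple_reflection !(geom_formDl, geom_formDr).
rewrite -!scaleNr !(geom_formZl, geom_formZr).
by rewrite form_simple1 (geom_formC (alpha s) v); ring.
Qed.

Lemma actD w u v : act w (u + v) = act w u + act w v.
Proof. by elim: w => //= s w ->; rewrite reflD. Qed.

Lemma actZ w a u : act w (a *: u) = a *: act w u.
Proof. by elim: w => //= s w ->; rewrite reflZ. Qed.

Lemma act_cat w w' u : act (w ++ w') u = act w (act w' u).
Proof. by elim: w => //= s w ->. Qed.

Lemma act_rcons w s u : act (rcons w s) u = act w (refl s u).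
Proof. by rewrite -cats1 act_cat. Qed.

Lemma act_rev w : cancel (act w) (act (rev w)).
Proof.
elim: w => //= s w IHw u; rewrite rev_cons act_rcons reflK; exact: IHw.
Qed.

Lemma act_revK w : cancel (act (rev w)) (act w).
Proof. by move=> u; rewrite -{1}(revK w) act_rev. Qed.

Lemma form_act w u v : form (act w u) (act w v) = form u v.
Proof. by elim: w => //= s w IHw; rewrite form_refl. Qed.

Lemma refl_pair i j (p q : R) : refl j (p *: alpha i + q *: alpha j) =
  p *: alpha i + (2 * p * cos (pi / (m i j)%:R) - q) *: alpha j.
Proof.
rewrite reflD !reflZ refl_simple /simple_reflection form_simple scalerBr scalerA.
rewrite scalerN -addrA -opprD -scalerDl -scaleNr; congr (_ + _ *: _).
by ring.
Qed.

(** The word of length [n] ends in [t], the letter that acts first, and grows on the left, so that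
    an orbit is followed one reflection at a time. *)
Fixpoint alternating s t n : seq S :=
  if n is n'.+1 then (if odd n' then s else t) :: alternating s t n' else [::].

Lemma size_alternating s t n : size (alternating s t n) = n.
Proof. by elim: n => //= n ->. Qed.

Lemma alternating_split s t n k : exists2 w, size w = n &
  alternating s t (n + k) = w ++ alternating s t k.
Proof.
elim: n => [|n [w <- wE]]; first by exists [::].
by exists ((if odd (size w + k) then s else t) :: w); rewrite //= wE.
Qed.

Lemma alternating_rcons s t n :
  rcons (alternating s t n) s = alternating t s n.+1.
Proof.
elim: n => //= n IHn; rewrite IHn /=; congr (_ :: _); by case: (odd n).
Qed.

Section Dihedral.
Variables s t : S.
Hypothesis st : s != t.
Local Notation theta := (pi / (m s t)%:R : R).

Lemma m_gt1 : (1 < m s t)%N.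
Proof. by have [_ _ m2] := cox; apply: m2. Qed.

Lemma sin_theta_gt0 : 0 < sin theta.
Proof.
have m0 : 0 < ((m s t)%:R : R) by rewrite ltr0n (ltn_trans _ m_gt1).
apply: sin_gt0_pi; rewrite divr_gt0 ?pi_gt0 //= ltr_pdivrMr //.
by rewrite ltr_pMr ?pi_gt0 // ltr1n m_gt1.
Qed.

Lemma sin_step k : 2 * sin (k.+1%:R * theta) * cos theta - sin (k%:R * theta)
  = sin (k.+2%:R * theta).
Proof.
have -> : k.+2%:R * theta = k.+1%:R * theta + theta.
  by rewrite -[k.+2%:R]natr1 mulrDl mul1r.
have -> : k%:R * theta = k.+1%:R * theta - theta.
  by rewrite -[k.+1%:R]natr1; ring.
by rewrite sinB sinD; ring.
Qed.

(** Scaling the root by [sin theta] turns the coefficients, which are quotients of sines, into plain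
    sines obeying the recurrence [sin_step]. *)
Lemma dihedral_orbit k : act (alternating s t k) (sin theta *: alpha s) =
  (if odd k then sin (k%:R * theta) else sin (k.+1%:R * theta)) *: alpha s
  + (if odd k then sin (k.+1%:R * theta) else sin (k%:R * theta)) *: alpha t.
Proof.
have [_ mC _] := cox.
elim: k => [|k IHk]; first by rewrite /= mul0r sin0 mul1r scale0r addr0.
rewrite [alternating _ _ _]/= [act _ _]/= IHk [odd k.+1]/=; case: (odd k) => /=.
  by rewrite addrC refl_pair (mC t) sin_step addrC.
by rewrite refl_pair sin_step.
Qed.

Lemma dihedral_simple : act (alternating s t (m s t).*2) (alpha s) = alpha s.
Proof.
have m0 : ((m s t)%:R : R) != 0 by rewrite pnatr_eq0 -lt0n (ltn_trans _ m_gt1).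
have thE : (m s t).*2%:R * theta = pi + pi.
  by rewrite -muln2 natrM mulrAC [_ * theta]mulrC divfK // mulr_natr mulr2n.
have thE1 : (m s t).*2.+1%:R * theta = pi + pi + theta.
  by rewrite -thE -[_.+1%:R]natr1; ring.
have := dihedral_orbit (m s t).*2; rewrite odd_double thE thE1.
rewrite [pi + pi + _]addrC addrA !sinDpi sinpi oppr0 scale0r addr0 opprK actZ.
by apply: scalerI; rewrite gt_eqF ?sin_theta_gt0.
Qed.

End Dihedral.

Lemma alternating_rev s t n : rev (alternating s t n) =
  if odd n then alternating s t n else alternating t s n.
Proof.
elim: n => //= n IHn; rewrite rev_cons IHn; case oddn: (odd n) => /=.
  by rewrite alternating_rcons /= oddn.
by rewrite alternating_rcons /= oddn.
Qed.

Lemma act_alternating_fixed s t n u : form u (alpha s) = 0 -> form u (alpha t) = 0 ->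
  act (alternating s t n) u = u.
Proof.
move=> us ut; elim: n => //= n ->; rewrite /simple_reflection.
by case: (odd n); rewrite ?us ?ut mulr0 scale0r subr0.
Qed.

(** The form is nondegenerate on the plane of the two simple roots, so [u] splits into a part in the
    plane, fixed by [dihedral_simple], and a part orthogonal to it, fixed by both reflections. *)
Lemma dihedral_relation s t u : s != t -> act (alternating s t (m s t).*2) u = u.
Proof.
move=> st; have [_ mC _] := cox.
have as_ := dihedral_simple st.
have at_ : act (alternating s t (m s t).*2) (alpha t) = alpha t.
  have ts : t != s by rewrite eq_sym.
  rewrite -{1}(dihedral_simple ts) (mC t s).
  have -> : alternating t s (m s t).*2 = rev (alternating s t (m s t).*2).
    by rewrite alternating_rev odd_double.
  by rewrite act_revK.
pose c : R := cos (pi / (m s t)%:R).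
have c1 : 1 - c ^+ 2 != 0.
  by rewrite -sin2cos2 expf_eq0 /= gt_eqF ?sin_theta_gt0.
pose p := form u (alpha s); pose q := form u (alpha t).
(* Solution of the system [x - c y = p], [y - c x = q] given by the Gram matrix of the two roots. *)
pose x := (p + q * c) / (1 - c ^+ 2); pose y := (q + p * c) / (1 - c ^+ 2).
have [u0 uE form_u0] : exists2 u0, u = u0 + (x *: alpha s + y *: alpha t) &
    forall i, form u0 (alpha i) =
    form u (alpha i) - (x * form (alpha s) (alpha i) + y * form (alpha t) (alpha i)).
  exists (u - (x *: alpha s + y *: alpha t)); first by rewrite subrK.
  by move=> i; rewrite -scaleN1r geom_formDl geom_formZl geom_formDl !geom_formZl; ring.
have us : form u0 (alpha s) = 0.
  by rewrite form_u0 form_simple1 form_simple (mC t s) -/c -/p /x /y; field.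
have ut : form u0 (alpha t) = 0.
  by rewrite form_u0 form_simple1 form_simple -/c -/q /x /y; field.
by rewrite uE !actD !actZ as_ at_ act_alternating_fixed.
Qed.

Lemma act_alternating_double s t n u :
  act (alternating s t n.*2) u = iter n (fun v => refl s (refl t v)) u.
Proof. by elim: n => //= n <-; rewrite odd_double. Qed.

(** * Word length and the sign of roots *)

Definition nonneg u := forall s, 0 <= u s.

(** Words are compared through their action, so lengths are taken in the group of linear maps
    generated by the reflections. *)
Definition same_action w w' := act w =1 act w'.

Definition reduced w := forall w', same_action w w' -> (size w <= size w')%N.

(** The inequality is weak, so that its negation directly provides a strictly shorter word, without
    a parity argument. *)
Definition ascent w s := forall w', same_action (rcons w s) w' -> (size w <= size w')%N.

Lemma nonneg_comb (p q : R) u v : 0 <= p -> 0 <= q -> nonneg u -> nonneg v ->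
  nonneg (p *: u + q *: v).
Proof. by move=> p0 q0 u0 v0 s; rewrite !ffunE addr_ge0 // mulr_ge0. Qed.

Lemma nonneg_simple s : nonneg (alpha s).
Proof. by move=> t; rewrite ffunE ler0n. Qed.

Lemma exists_reduced w : exists2 w', reduced w' & same_action w w'.
Proof.
have [n] := ubnP (size w); elim: n w => // n IHn w; rewrite ltnS => wn.
have [rw|nrw] := pselect (reduced w); first by exists w.
have [w' ww' lt_w'] : exists2 w', same_action w w' & (size w' < size w)%N.
  apply: contrapT => no; apply: nrw => w' ww'; rewrite leqNgt; apply/negP => lt_w'.
  by apply: no; exists w'.
have [w'' rw'' w'w''] := IHn w' (leq_trans lt_w' wn).
by exists w'' => // u; rewrite ww' w'w''.
Qed.

Lemma alternating_cons s t x n : x \in pred2 s t ->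
  [\/ x :: alternating s t n = alternating s t n.+1,
      x :: alternating s t n = alternating t s n.+1 |
      exists2 w, (size w < n.+1)%N & same_action (x :: alternating s t n) w].
Proof.
case: n => [|n] xst.
  by move: xst; rewrite inE => /orP[]/eqP ->; [apply: Or32 | apply: Or31].
have [->|nx] := eqVneq x (if odd n then s else t).
  apply: Or33; exists (alternating s t n); first by rewrite size_alternating ltnW.
  by move=> u /=; rewrite reflK.
apply: Or31; rewrite [RHS]/=; congr (_ :: _).
by move: xst nx; rewrite inE /=; case: (odd n) => /= /orP[]/eqP -> // /eqP.
Qed.

(** A word in two letters alternates unless two equal neighbours cancel. *)
Lemma dihedral_word s t w : all (pred2 s t) w ->
  [\/ w = alternating s t (size w), w = alternating t s (size w) |
      exists2 w', (size w' < size w)%N & same_action w w'].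
Proof.
elim: w => [_|x w IHw /= /andP[xst /IHw]]; first exact: Or31.
case=> [wE|wE|[w' lt_w' ww']].
- rewrite wE size_alternating; exact: alternating_cons.
- have xts : x \in pred2 t s by rewrite inE orbC.
  rewrite wE size_alternating; have [||] := alternating_cons (size w) xts => xE.
  + exact: Or32.
  + exact: Or31.
  + exact: Or33.
- by apply: Or33; exists (x :: w') => // u; rewrite /= ww'.
Qed.

(** The alternating word of length [2m] acts trivially, so its last [m + 1] letters act as the
    reverse of its first [m - 1]. *)
Lemma dihedral_shorten s t : s != t ->
  exists2 w, size w = (m s t).-1 & same_action (alternating t s (m s t).+1) w.
Proof.
move=> st; have m2 := m_gt1 st; have [_ mC _] := cox.
have [z zs zE] := alternating_split t s (m s t).-1 (m s t).+1.
exists (rev z); first by rewrite size_rev.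
move=> u; rewrite -[LHS](act_rev z); congr (act _ _); rewrite -act_cat -zE.
have -> : ((m s t).-1 + (m s t).+1)%N = (m t s).*2.
  by rewrite (mC t s) -addnn; move: m2; case: (m s t) => //= k; lia.
by rewrite dihedral_relation // eq_sym.
Qed.

(* Write [w = v u] with [u] a word in [s] and the last letter [t] of [w], and [v]
   as short as possible.  Then [s] and [t] are ascents of [v], and [u] maps
   [alpha s] to a nonnegative combination of [alpha s] and [alpha t]. *)
Lemma ascent_nonneg w s : reduced w -> ascent w s -> nonneg (act w (alpha s)).
Proof.
have [n] := ubnP (size w); elim: n w s => // n IHn w s; rewrite ltnS => wn rw asc.
have [->|[w1 [t wE]]] : w = [::] \/ exists w1 t, w = rcons w1 t.
- by case: (lastP w) => [|w1 t]; [left | right; exists w1, t].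
- exact: nonneg_simple.
have st : s != t.
  apply/eqP => st; have := asc w1; rewrite wE size_rcons ltnn => /(_ _)/notF; apply.
  by move=> u; rewrite !act_rcons st reflK.
pose P k := `[< exists v u : seq S,
  [/\ size v = k, all (pred2 s t) u, same_action w (v ++ u)
   & (size v + size u = size w)%N] >].
have exP : exists k, P k.
  exists (size w1); apply/asboolP; exists w1, [:: t]; split=> //.
  - by rewrite /= eqxx orbT.
  - by move=> u; rewrite wE cats1.
  - by rewrite wE size_rcons addn1.
case: (ex_minnP exP) => k /asboolP[v [u [vk ust wvu szE]]] kmin.
have vw : (size v < size w)%N.
  rewrite vk wE size_rcons ltnS; apply: kmin; apply/asboolP.
  exists w1, [:: t]; split=> //.
  - by rewrite /= eqxx orbT.
  - by move=> x; rewrite wE cats1.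
  - by rewrite wE size_rcons addn1.
have rv : reduced v.
  move=> v' vv'; have := rw (v' ++ u).
  rewrite -szE size_cat leq_add2r; apply=> x.
  by rewrite wvu !act_cat vv'.
(* If appending [r] shortened [v], moving [r] over to [u] would give a factorization with a shorter
   left factor. *)
have ascv r : r \in pred2 s t -> ascent v r.
  move=> rst v' vv'; rewrite leqNgt; apply/negP => lt_v'.
  have wE' : same_action w (v' ++ r :: u).
    by move=> x; rewrite wvu !act_cat -vv' act_rcons /= reflK.
  have := rw _ wE'; rewrite -szE size_cat /= addnS -addSn leq_add2r => le_v.
  have v'E : (size v').+1 = size v by apply/eqP; rewrite eqn_leq lt_v'.
  have : (k <= size v')%N.
    apply: kmin; apply/asboolP; exists v', (r :: u); split=> //.
      by rewrite /= ust andbT.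
    by rewrite -szE -v'E /= addnS.
  by rewrite -vk leqNgt lt_v'.
have pos r : r \in pred2 s t -> nonneg (act v (alpha r)).
  by move=> rst; apply: IHn => //; [exact: leq_trans vw wn | exact: ascv].
have short_u (u' : seq S) : same_action u u' -> (size u <= size u')%N.
  move=> uu'; have := rw (v ++ u'); rewrite -szE size_cat leq_add2l; apply=> x.
  by rewrite wvu !act_cat uu'.
have short_us (u' : seq S) : same_action (rcons u s) u' -> (size u <= size u')%N.
  move=> uu'; have := asc (v ++ u'); rewrite -szE size_cat leq_add2l; apply=> x.
  by rewrite act_rcons wvu !act_cat -uu' act_rcons.
(* A non-alternating [u] could be shortened; an alternating one ending in [s] would make [rcons u s]
   shorter than [u], against the ascent. *)
have uE : u = alternating s t (size u).
  have [//|uE|[u' lt_u' /short_u]] := dihedral_word ust; last by rewrite leqNgt lt_u'.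
  case: (size u) uE short_us => [->//|j] uE short_us.
  have := short_us (alternating s t j); rewrite size_alternating ltnn => /(_ _)/notF.
  case; move=> x; rewrite act_rcons uE -alternating_rcons act_rcons reflK.
  by [].
(* Otherwise [rcons u s] ends in an alternating word of length [m + 1], which [dihedral_shorten]
   shortens by two. The bound keeps all angles below within [[0, pi]]. *)
have um : (size u < m s t)%N.
  rewrite ltnNge; apply/negP => mu.
  have [z zs zE] := alternating_split s t (size u - m s t) (m s t).
  rewrite subnK // -uE in zE.
  have [y ys yE] := dihedral_shorten st.
  have := short_us (z ++ y); rewrite size_cat zs ys.
  have -> : (size u <= size u - m s t + (m s t).-1)%N = false.
    by have := m_gt1 st; lia.
  move=> /(_ _)/notF; apply=> x.
  by rewrite zE rcons_cat alternating_rcons !act_cat yE.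
rewrite wvu act_cat uE; set k' := size u in um *.
have sn := sin_theta_gt0 st.
have m0 : 0 < ((m s t)%:R : R) by rewrite ltr0n (ltn_trans _ (m_gt1 st)).
have sinp j : (j <= m s t)%N -> 0 <= sin (j%:R * (pi / (m s t)%:R)) :> R.
  move=> jm; apply: sin_ge0_pi; rewrite mulr_ge0 ?divr_ge0 ?pi_ge0 ?ler0n //=.
  rewrite mulrA ler_pdivrMr // mulrC ler_pM2l ?pi_gt0 //.
  by rewrite ler_nat.
have -> : alpha s = (sin (pi / (m s t)%:R))^-1 *: (sin (pi / (m s t)%:R) *: alpha s).
  by rewrite scalerA mulVf ?gt_eqF // scale1r.
rewrite actZ dihedral_orbit // actZ actD !actZ => r.
rewrite ffunE mulr_ge0 ?invr_ge0 ?(ltW sn) //; apply: nonneg_comb.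
- by case: (odd k'); apply: sinp => //; apply: ltnW.
- by case: (odd k'); apply: sinp => //; apply: ltnW.
- by apply: pos; rewrite inE eqxx.
- by apply: pos; rewrite inE eqxx orbT.
Qed.

(** If [s] is not an ascent of a reduced word, it is one of a reduced word for the product with [s],
    which sends [alpha s] to the opposite vector. *)
Lemma act_simple_sign w s :
  nonneg (act w (alpha s)) \/ nonneg (- act w (alpha s)).
Proof.
have [w0 rw0 ww0] := exists_reduced w; rewrite ww0.
have [asc|nasc] := pselect (ascent w0 s); first by left; apply: ascent_nonneg.
right; have [w1 rw1 ww1] := exists_reduced (rcons w0 s).
have lt_w1 : (size w1 < size w0)%N.
  rewrite ltnNge; apply/negP => le_w; apply: nasc => w' ww'.
  by apply: leq_trans le_w _; apply: rw1 => u; rewrite -ww1 ww'.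
have -> : - act w0 (alpha s) = act w1 (alpha s).
  by rewrite -ww1 act_rcons refl_simple -!scaleN1r actZ.
apply: ascent_nonneg => // w' ww'; apply: ltnW; apply: leq_trans lt_w1 _.
by apply: rw0 => u; rewrite -ww' act_rcons -ww1 act_rcons reflK.
Qed.

End GeometricRepresentation.

(** * The positive roots of a finite Coxeter group form a root configuration *)

Section FiniteCoxeterGroup.
Variables (R : realType) (S : finType) (m : S -> S -> nat).
Variables (W : finGroupType) (gen : S -> W).
Hypothesis hW : coxeter_system m gen.
Local Notation V := (geom_space R S).
Local Notation form := (@geom_form R S m).
Local Notation alpha := (@simple_root R S).
Local Notation refl := (@simple_reflection R S m).
Local Notation act := (@word_action R S m).
Implicit Types (s t : S) (u v : V) (w : seq S).

Let cox : coxeter_matrix m.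
Proof. by case: hW. Qed.

Fact refl_linear s : linear (refl s).
Proof. by move=> a u v; rewrite reflD reflZ. Qed.

HB.instance Definition _ s :=
  GRing.isLinear.Build R V V *:%R (refl s) (refl_linear s).

Fact reflection_ker s : lker (linfun (refl s) : 'End(V)) == 0%VS.
Proof. by apply/lker0P => u v; rewrite !lfunE; apply: inv_inj; apply: reflK. Qed.

Definition reflection_aut s : lin_aut V := exist _ (linfun (refl s)) (reflection_ker s).

Lemma reflection_autE s v : val (reflection_aut s) v = refl s v.
Proof. by rewrite [val _]/= lfunE. Qed.

Lemma reflection_aut_relation s t :
  ((reflection_aut s * reflection_aut t) ^+ m s t = 1)%g.
Proof.
apply: val_inj; apply/lfunP => v; rewrite lin_autXE lin_aut1E.
have [<-|st] := eqVneq s t.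
  have [m1 _ _] := cox.
  rewrite m1 -[iter 1 _ _]/(val (reflection_aut s * reflection_aut s)%g v).
  rewrite lin_autME !reflection_autE.
  exact: reflK.
rewrite -[RHS](dihedral_relation cox v st) act_alternating_double.
by apply: eq_iter => u; rewrite lin_autME !reflection_autE.
Qed.

Lemma exists_representation : exists2 phi : W -> lin_aut V,
  {morph phi : x y / (x * y)%g} & forall s v, val (phi (gen s)) v = refl s v.
Proof.
have [_ _ _ univ] := hW.
have [phi phiM phiG] := univ _ _ reflection_aut_relation.
by exists phi => // s v; rewrite phiG reflection_autE.
Qed.

Section InvariantForm.
Variable phi : W -> lin_aut V.
Hypothesis phiM : {morph phi : x y / (x * y)%g}.
Hypothesis phi_gen : forall s v, val (phi (gen s)) v = refl s v.

Lemma phi1E v : val (phi 1%g) v = v.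
Proof.
suff -> : phi 1%g = 1%g by apply: lin_aut1E.
by apply: (mulgI (phi 1%g)); rewrite -phiM mulg1 mulg1.
Qed.

Definition invariant_form u v : R :=
  \sum_(g : W) \sum_s val (phi g) u s * val (phi g) v s.

Lemma invariant_formC u v : invariant_form u v = invariant_form v u.
Proof. by apply: eq_bigr => g _; apply: eq_bigr => s _; rewrite mulrC. Qed.

Lemma invariant_formDl u u' v :
  invariant_form (u + u') v = invariant_form u v + invariant_form u' v.
Proof.
rewrite /invariant_form -big_split; apply: eq_bigr => g _; rewrite -big_split.
by apply: eq_bigr => s _; rewrite linearD ffunE mulrDl.
Qed.

Lemma invariant_formZl a u v : invariant_form (a *: u) v = a * invariant_form u v.
Proof.
rewrite /invariant_form mulr_sumr; apply: eq_bigr => g _; rewrite mulr_sumr.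
by apply: eq_bigr => s _; rewrite linearZ ffunE -mulrA.
Qed.

Lemma invariant_form_eq0 u : invariant_form u u = 0 -> u = 0.
Proof.
have sq_ge0 g s : 0 <= val (phi g) u s * val (phi g) u s by rewrite -expr2 sqr_ge0.
move=> /psumr_eq0P u0; apply/ffunP => s; rewrite [RHS]ffunE.
have /psumr_eq0P u1 := u0 (fun g _ => sumr_ge0 _ (fun s _ => sq_ge0 g s)) 1%g isT.
have := u1 (fun s _ => sq_ge0 1%g s) s isT; rewrite phi1E => /eqP.
by rewrite mulf_eq0 orbb => /eqP.
Qed.

Lemma invariant_form_refl s u v :
  invariant_form (refl s u) (refl s v) = invariant_form u v.
Proof.
rewrite /invariant_form [RHS](reindex_inj (mulIg (gen s))) /=.
by apply: eq_bigr => g _; apply: eq_bigr => t _; rewrite phiM !lin_autME !phi_gen.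
Qed.

Lemma invariant_form_act w u v :
  invariant_form (act w u) (act w v) = invariant_form u v.
Proof. by elim: w => //= s w IHw; rewrite invariant_form_refl. Qed.

(** The reflection preserves the averaged form and negates [alpha s]; comparing the two expressions
    for the pairing gives the factor. Hence both forms agree on orthogonality to [alpha s]. *)
Lemma invariant_form_simple s u :
  invariant_form u (alpha s) = form u (alpha s) * invariant_form (alpha s) (alpha s).
Proof.
have := invariant_form_refl s u (alpha s).
rewrite refl_simple // -scaleN1r invariant_formC invariant_formZl invariant_formC.
rewrite {1}/simple_reflection -scaleNr invariant_formDl invariant_formZl.
by move=> ?; lra.
Qed.

Lemma is_root_act w v : is_root m v -> is_root m (act w v).
Proof. by move=> [w' [s ->]]; exists (w ++ w'), s; rewrite act_cat. Qed.

Lemma is_root_opp v : is_root m v -> is_root m (- v).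
Proof.
move=> [w [s ->]]; exists (rcons w s), s.
by rewrite act_rcons refl_simple // -!scaleN1r actZ.
Qed.

Lemma is_root_form v : is_root m v -> form v v = 1.
Proof. by move=> [w [s ->]]; rewrite form_act // form_simple1. Qed.

Lemma is_root_sign v : is_root m v -> is_positive_root m v \/ is_positive_root m (- v).
Proof.
move=> rv; have [w [s vE]] := rv.
have [] := @act_simple_sign R _ _ cox w s; rewrite -vE => v0; [left|right]; split=> //.
exact: is_root_opp.
Qed.

(* The reflection in the root [v = w alpha_s] is [w s w^-1]. *)
Lemma is_root_reflect u v : is_root m u -> is_root m v -> invariant_form u v != 0 ->
  exists2 k, k != 0 & is_root m (u - k *: v).
Proof.
move=> ru [w [s vE]] uv.
pose u' := act (rev w) u; exists (2 * form u' (alpha s)).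
  rewrite mulf_neq0 ?pnatr_eq0 //; apply: contraNneq uv => f0.
  by rewrite vE -(act_revK cox w u) invariant_form_act invariant_form_simple f0 mul0r.
have -> : u - (2 * form u' (alpha s)) *: v = act (w ++ s :: rev w) u.
  rewrite act_cat /= -/u' [refl s u']/simple_reflection -[in RHS]scaleNr.
  by rewrite actD actZ -vE (act_revK cox) scaleNr.
exact: is_root_act.
Qed.

(** Each root is the image of a simple root under some [phi g], with [g] in the finite group [W]. *)
Lemma finite_positive_roots : finite_set [set v : V | is_positive_root m v]%classic.
Proof.
apply: (@sub_finite_set _ _
  [set val (phi g) (alpha s) | g in [set: W] & s in [set: S]]%classic).
  move=> _ [[w [s ->]] _].
  have [g gE] : exists g, forall v, act w v = val (phi g) v.
    elim: w => [|t w [g gE]]; first by exists 1%g => v; rewrite phi1E.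
    by exists (gen t * g)%g => v; rewrite /= phiM lin_autME phi_gen gE.
  by exists g => //; exists s => //; rewrite gE.
by apply: finite_image2; apply: finite_finset.
Qed.

Lemma positive_rootP (x : positive_roots R m) : is_positive_root m (\val x).
Proof.
have := valP x; rewrite in_fset_set; last exact: finite_positive_roots.
by rewrite inE.
Qed.

Lemma exists_positive_root v : is_positive_root m v ->
  exists x : positive_roots R m, \val x = v.
Proof.
move=> pv; have vP : v \in positive_roots R m.
  by rewrite in_fset_set ?inE //; exact: finite_positive_roots.
by exists (FSetSub vP).
Qed.

Lemma positive_roots_configuration :
  root_configuration (fun x : positive_roots R m => \val x : V) invariant_form.
Proof.
have neq0 v : is_root m v -> v != 0.
  move=> /is_root_form; apply: contra_eqN => /eqP ->.
  by rewrite -(scale0r 0) geom_formZl mul0r eq_sym oner_eq0.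
split.
- exact: invariant_formC.
- exact: invariant_formDl.
- exact: invariant_formZl.
- exact: invariant_form_eq0.
- by move=> x; apply: neq0; have [] := positive_rootP x.
- move=> x y; apply: contra => /vlineP[c xy].
  have [rx px] := positive_rootP x; have [ry py] := positive_rootP y.
  have := is_root_form rx; rewrite xy geom_formZl geom_formZr // is_root_form // mulr1.
  (* Roots have norm 1 for the geometric form, so proportional ones are equal or opposite; opposite
     positive vectors would vanish. *)
  move=> /eqP; rewrite -expr2 sqrf_eq1 => /orP[]/eqP c1.
    by apply/eqP/val_inj; rewrite xy c1 scale1r.
  have /eqP : \val x = 0; last by rewrite (negbTE (neq0 _ rx)).
  apply/ffunP => s; rewrite [RHS]ffunE; apply/le_anti/andP; split; last exact: px.
  by rewrite xy c1 scaleN1r ffunE oppr_le0.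
- move=> x y _ xy; have [rx _] := positive_rootP x; have [ry _] := positive_rootP y.
  (* The reflected vector is a root, but only it or its opposite is in the ground set; either serves
     as third root. *)
  have [k k0 rk] := is_root_reflect rx ry xy.
  have [/exists_positive_root[z zE]|/exists_positive_root[z zE]] := is_root_sign rk.
    by exists z, 1, (- k); rewrite oner_neq0 oppr_eq0 k0 scale1r scaleNr zE.
  exists z, (- 1), k; rewrite oppr_eq0 oner_neq0 k0 scaleN1r zE opprB addrC.
  by split.
Qed.

End InvariantForm.

Lemma coxeter_root_configuration :
  exists ip, root_configuration (fun x : positive_roots R m => \val x : V) ip.
Proof.
have [phi phiM phi_gen] := exists_representation.
by exists (invariant_form phi); apply: positive_roots_configuration.
Qed.

End FiniteCoxeterGroup.

Theorem theorem2 (R : realType) (S : finType) (m : S -> S -> nat)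
    (W : finGroupType) (gen : S -> W) (hW : coxeter_system m gen) :
  [/\ forall w v : {ffun positive_roots R m -> R},
        bergman (root_matroid R m) w -> bergman (root_matroid R m) v ->
        (flag_matroid (root_matroid R m) (level_flag w)
           = flag_matroid (root_matroid R m) (level_flag v)
         <->
         flag_components (root_matroid R m) (level_flag w)
           = flag_components (root_matroid R m) (level_flag v)),
      coarse_subdivision R (root_matroid R m)
        = nested_set_complex R (root_matroid R m)
    & simplicial_complex_mod (lineality R (root_matroid R m))
        (coarse_subdivision R (root_matroid R m))].
Proof.
have [ip cfg] := coxeter_root_configuration R hW.
split.
- exact: (flag_matroid_components cfg).
- exact: (coarse_nested_subdivision cfg).
- rewrite (coarse_nested_subdivision cfg).
  exact: (nested_simplicial_complex cfg).
Qed.
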